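(* There exists a universal constant $c>0$ such that for all integers $k\ge1$, $$\min_{\pi}\max_{D\in\mathcal{D}(\tilde C,L)}\mathrm{Regret}_T(\pi)\ge c\,T^{2/3},\qquad \min_{\pi}\max_{D\in\mathcal{D}^{(k)}(\tilde C,L)}\mathrm{Regret}_T(\pi)\ge c\sqrt{kT}.$$
   Context: **Bandit model.** Two arms $0,1$; contexts in $[0,1]$; horizon of $T$ rounds. The triples $(X_i,Y_i(0),Y_i(1))$, $i\ge1$, are i.i.d. with law $D$. In round $i$ one sees $X_i$, draws an arm $A_i\in\{0,1\}$, and observes $Y_i(A_i)$. With $\mathscr{F}_t=\sigma(\{X_i,Y_i(A_i):i\le t\})$, a policy $\pi$ is a scheme in which each $A_{t+1}$ is a $\{0,1\}$-valued function measurable with respect to $\sigma(\mathscr{F}_t,X_{t+1})$. Let $\mathcal{F}_{[0,1]\uparrow}$ be the set of non-decreasing $F:[0,1]\to\mathbb{R}$ with $0\le F\le1$, and $\mathcal{F}^{(k)}_{[0,1]\uparrow}$ the subset of those that are piecewise constant with $k$ constant pieces. For constants $\tilde C,L>0$, $\mathcal{D}(\tilde C,L)$ is the set of laws of $(X,Y(0),Y(1))$ such that: (i) $X\sim\mathrm{Unif}(0,1)$; (ii) $Y(0)=F_0(X)+\varepsilon$, $Y(1)=F_1(X)+\varepsilon$ with $F_0,F_1\in\mathcal{F}_{[0,1]\uparrow}$, $\varepsilon$ independent of $X$, $\mathbb{E}[\varepsilon]=0$, and $\varepsilon$ symmetric about $0$; (iii) the CDF $F$ of $\varepsilon$ satisfies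 Assumption A with parameters $\tilde C,L$: $|F(t)-F(0)|>\tilde C|t|$ for all nonzero $t\in[-L,L]$. $\mathcal{D}^{(k)}(\tilde C,L)\subset\mathcal{D}(\tilde C,L)$ is the subset where both $F_0,F_1\in\mathcal{F}^{(k)}_{[0,1]\uparrow}$. With $F_*=\max\{F_0,F_1\}$, $\mathrm{Regret}_T(\pi)=\sum_{i=1}^T\mathbb{E}[F_*(X_i)-Y_i(A_i)]$. The minimum (infimum) is over all policies, and the maximum is a supremum over data generating laws.
   Formalization: The √(kT) bound is stated for T ≥ k³ (it fails for k large against T, as regret is at most T); c may depend on C̃ and L (no c serves all C̃, L), but not on k, T; the class 𝒟(C̃,L) is assumed nonempty (it is empty when C̃L ≥ 1/2). *)

(* Defs.v *)
From HB Require Import structures.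
From mathcomp Require Import all_boot all_order all_algebra.
From mathcomp Require Import all_classical all_reals all_analysis.

Set Implicit Arguments.
Unset Strict Implicit.
Unset Printing Implicit Defensive.

Import Order.TTheory GRing.Theory Num.Theory.
Import numFieldNormedType.Exports.

Local Open Scope classical_set_scope.
Local Open Scope ring_scope.

(* A point (x, (y0, y1)) is a value of (X, (Y(0), Y(1))).  Arms are booleans:
   arm 0 is [false] and arm 1 is [true]. *)
Notation triple R := (R * (R * R))%type.

Section Bandit.
Variable R : realType.

Definition context (z : triple R) : R := z.1.

Definition outcome (z : triple R) (a : bool) : R :=
  if a then z.2.2 else z.2.1.

(* Regression functions are total on R; only their values on [0, 1] matter. *)
Definition monotone01 (F : R -> R) : Prop :=
  {in `[0, 1] &, {homo F : x y / x <= y}} /\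
  {in `[0, 1], forall x, 0 <= F x <= 1}.

(* Exactly k pieces: [0, 1] is cut into k nonempty intervals on which F is
   constant, with different values on different intervals. *)
Definition piecewise_constant (k : nat) (F : R -> R) : Prop :=
  exists (J : 'I_k -> set R) (v : 'I_k -> R),
    [/\ partition [set: 'I_k] J `[0, 1]%classic,
        forall j, is_interval (J j),
        injective v &
        forall j x, J j x -> F x = v j].

Definition assumptionA (Ctil L : R) (D : probability (triple R) R)
    (eps : {RV D >-> R}) : Prop :=
  forall t : R, t != 0 -> t \in `[- L, L] ->
    ((Ctil * `|t|)%:E < `|cdf eps t - cdf eps 0|)%E.

(* laws Ctil L D F: the law D belongs to the class, with F a the regression
   function of arm a.  D determines F a only almost everywhere on [0, 1], so
   the pair (D, F) is the object over which suprema are taken. *)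
Definition laws (Ctil L : R) (D : probability (triple R) R)
    (F : bool -> R -> R) : Prop :=
  [/\ forall S : set R, measurable S ->
        D (context @^-1` S) = uniform_prob (@ltr01 R) S,
      forall a, monotone01 (F a) &
      exists eps : {RV D >-> R},
        [/\ {ae D, forall z, forall a,
              outcome z a = F a (context z) + eps z},
            forall S S' : set R, measurable S -> measurable S' ->
              D (context @^-1` S `&` eps @^-1` S') =
              (D (context @^-1` S) * D (eps @^-1` S'))%E,
            D.-integrable setT (EFin \o eps) /\ ('E_D[eps] = 0)%E,
            forall S : set R, measurable S ->
              D (eps @^-1` S) = D ((fun z => - eps z) @^-1` S) &
            assumptionA Ctil L eps]].

Definition Fstar (F : bool -> R -> R) (x : R) : R :=
  Num.max (F false x) (F true x).

Definition laws_k (k : nat) (Ctil L : R) (D : probability (triple R) R)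
    (F : bool -> R -> R) : Prop :=
  laws Ctil L D F /\ forall a, piecewise_constant k (F a).

Section Horizon.
Variable T : nat.

(* The sample space of T rounds; coordinate i : 'I_T is round i + 1. *)
Notation sample := (T.-tuple (triple R)).

(* P is the T-fold product of D. *)
Definition iid_law (D : probability (triple R) R) (P : probability sample R) :
    Prop :=
  forall S : 'I_T -> set (triple R), (forall i, measurable (S i)) ->
    P [set w | forall i, S i (tnth w i)] = (\prod_(i < T) D (S i))%E.

Definition X_ (i : 'I_T) (w : sample) : R := context (tnth w i).

Definition Y_ (A : 'I_T -> sample -> bool) (i : 'I_T) (w : sample) : R :=
  outcome (tnth w i) (A i w).

(* The sigma-algebra generated by the past (X_j, Y_j(A_j)), j < i, together
   with the current context X_i. *)
Definition information (A : 'I_T -> sample -> bool) (i : 'I_T) :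
    set (set sample) :=
  <<s (\bigcup_(j in [set j : 'I_T | (j <= i)%N])
         preimage_set_system setT (X_ j) measurable)
      `|` (\bigcup_(j in [set j : 'I_T | (j < i)%N])
             preimage_set_system setT (Y_ A j) measurable) >>.

Definition policy : set ('I_T -> sample -> bool) :=
  [set A | forall i b, information A i (A i @^-1` [set b])].

Definition regret (P : probability sample R) (F : bool -> R -> R)
    (A : 'I_T -> sample -> bool) : \bar R :=
  (\sum_(i < T) 'E_P[(fun w => Fstar F (X_ i w) - Y_ A i w)%R])%E.

Definition minimax_regret
    (C : probability (triple R) R -> (bool -> R -> R) -> Prop) : \bar R :=
  ereal_inf [set ereal_sup [set r | exists D F P,
      [/\ C D F, iid_law D P & r = regret P F A]] | A in policy].

End Horizon.
End Bandit.

(* Main.v *)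
Require Import Defs.
From HB Require Import structures.
From mathcomp Require Import all_boot all_order all_algebra ring lra.
From mathcomp Require Import all_classical all_reals all_analysis.
From mathcomp Require Import measurable_realfun.

Set Implicit Arguments.
Unset Strict Implicit.
Unset Printing Implicit Defensive.

Import Order.TTheory GRing.Theory Num.Theory.
Import numFieldNormedType.Exports.

Local Open Scope classical_set_scope.
Local Open Scope ring_scope.

(** Why the theorem holds.

    Cut [0, 1] into k bins of equal length.  Arm 0 has an increasing staircase
    as regression function, with one step per bin; arm 1 has the same staircase
    shifted on bin j by +delta or -delta according to a hidden sign s j.  If
    delta <= 1 / (8 k) both functions are non-decreasing with k pieces, and
    pulling the wrong arm costs exactly delta.  A bin sees about T / k rounds,
    so its sign cannot be learnt when delta is of order sqrt (k / T), and a
    constant fraction of the T pulls is wrong: the regret is of order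
    delta * T = sqrt (k T).  The constraint delta <= 1 / (8 k) is k ^ 3 <= T.
    Taking k of order T ^ (1/3) gives the bound for the whole class.

    The noise is Laplace with a large rate rho.  Its distribution function is
    concave on the right of 0, which makes Assumption A a condition at t = L
    only; as the class is nonempty, 2 * Ctil * L < 1, and a large rate meets
    it (laplace_assumptionA, laws_slope_bound).  Moreover the logarithm of its
    density is rho-Lipschitz, so that shifting the mean by d changes the square
    root of the density by a factor 1 + O(rho * d) (sqrt_ratio_close).

    Both outcomes of a round carry the same noise, so the full samples under
    two sign vectors are mutually singular, and only what the policy observes
    can be compared.  A decision depends on the observed contexts and rewards
    alone (policy_nonanticipating); it may hence be evaluated on the fictitious
    sample in which both outcomes equal the observed reward.  Let mu be the law
    of T i.i.d. pairs (context, noise).  The law of the observed history has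
    density sqrt_lik ^ 2 with respect to mu, where sqrt_lik is the product
    over the past rounds of the square roots of the density ratios; this comes
    from replacing the noises by the rewards one round after the other
    (integral_observed).

    For two sign vectors that differ on bin j only, with square-root
    likelihoods M and M', the affinity (the mu-integral of M * M') starts at 1
    and loses at most (2 rho delta) ^ 2 / (2 k) per round: the two laws of a
    reward differ only if the context falls in the bin, which has probability
    1 / k and is independent of the past (affinity_step).  As T such losses
    stay below 1/4, the inequality M M' <= min(M^2, M'^2) + (M^2 + M'^2) / 4
    bounds from below the sum of the error probabilities under the two sign
    vectors (two_point).  Averaging over all sign vectors, paired by flipping
    the sign of bin j, gives one under which a constant fraction of the pulls
    is wrong (flip_average, regret_staircase). *)

(** * Laplace noise *)

Section Density.
Local Open Scope ereal_scope.
Context d (T : measurableType d) (R : realType).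
Variables (mu nu : {measure set T -> \bar R}) (p : T -> R).
Hypotheses (mp : measurable_fun setT p) (p0 : forall x, (0 <= p x)%R).
Hypothesis nuE : forall A, measurable A -> nu A = \int[mu]_(x in A) (p x)%:E.

Import HBNNSimple.

(** By linearity from indicators to simple functions, then by monotone
    convergence. *)
Lemma ge0_integral_density (f : T -> \bar R) :
  measurable_fun setT f -> (forall x, 0 <= f x) ->
  \int[nu]_x f x = \int[mu]_x (f x * (p x)%:E).
Proof.
move=> mf f0.
have mpE : measurable_fun setT (EFin \o p) by exact/measurable_EFinP.
have indicE A : measurable A -> \int[nu]_x (\1_A x)%:E =
    \int[mu]_x ((\1_A x)%:E * (p x)%:E).
  move=> mA; rewrite integral_indic// setIT nuE// integral_mkcond/=.
  apply: eq_integral => x _; rewrite patchE indicE.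
  by case: ifPn => _; rewrite ?mul1e ?mul0e.
have nnsfunE (g : {nnsfun T >-> R}) : \int[nu]_x (g x)%:E =
    \int[mu]_x ((g x)%:E * (p x)%:E).
  under eq_integral do rewrite fimfunE -fsumEFin//.
  rewrite ge0_integral_fsum//; last 2 first.
    by move=> r; exact/measurable_EFinP/measurable_funM.
    by move=> r x _; rewrite nnfun_muleindic_ge0.
  under [RHS]eq_integral.
    move=> x _; rewrite fimfunE -fsumEFin// ge0_mule_fsuml; last first.
      by move=> r; rewrite nnfun_muleindic_ge0.
    over.
  rewrite ge0_integral_fsum//; last 2 first.
    move=> r; apply: emeasurable_funM => //.
    exact/measurable_EFinP/measurable_funM.
    by move=> r x _; rewrite mule_ge0 ?nnfun_muleindic_ge0 ?lee_fin.
  apply: eq_fsbigr => r _.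
  have [r0|r0] := ltP r 0%R.
    rewrite preimage_nnfun0// !integral0_eq// => x _;
    by rewrite indic0 mulr0 ?mul0e.
  under eq_integral do rewrite EFinM.
  rewrite ge0_integralZl//; last 1 first.
    exact/measurable_EFinP.
  under [RHS]eq_integral do rewrite EFinM -muleA.
  rewrite ge0_integralZl//; last 2 first.
    by apply: emeasurable_funM => //; exact/measurable_EFinP.
    by move=> x _; rewrite mule_ge0// lee_fin.
  by rewrite indicE.
pose f_ := nnsfun_approx measurableT mf.
transitivity (limn (fun n => \int[nu]_x (f_ n x)%:E)).
  rewrite -monotone_convergence//.
  - apply: eq_integral => y _; apply/esym/cvg_lim => //.
    exact: cvg_nnsfun_approx.
  - by move=> n; exact/measurable_EFinP/measurable_funP.
  - by move=> n y _; rewrite lee_fin.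
  - by move=> y _ m n mn; rewrite lee_fin; exact/lefP/nd_nnsfun_approx.
transitivity (limn (fun n => \int[mu]_x ((f_ n x)%:E * (p x)%:E))).
  by congr (limn _); apply/funext => n; exact: nnsfunE.
rewrite -monotone_convergence//.
- apply: eq_integral => y _; apply/cvg_lim => //.
  apply: cvgeZr => //.
  exact: cvg_nnsfun_approx.
- move=> n; apply: emeasurable_funM => //.
  exact/measurable_EFinP/measurable_funP.
- by move=> n y _; rewrite mule_ge0// lee_fin.
- move=> y _ m n mn; rewrite lee_pmul// ?lee_fin//.
  exact/lefP/nd_nnsfun_approx.
Qed.

End Density.

Section Laplace.
Context {R : realType}.
Implicit Types (rho : R).
Notation mu := (@lebesgue_measure R).

Definition laplace_pdf rho (x : R) : R := rho / 2 * expR (- rho * `|x|).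

Lemma laplace_pdf_ge0 rho x : 0 < rho -> 0 <= laplace_pdf rho x.
Proof. by move=> r0; rewrite mulr_ge0 ?expR_ge0 ?divr_ge0 ?ltW. Qed.

Lemma continuous_laplace_pdf rho : continuous (laplace_pdf rho).
Proof.
move=> x; apply: cvgMr; apply: continuous_comp; last exact: continuous_expR.
by apply: cvgMr; exact: (@norm_continuous _ R^o).
Qed.

Lemma measurable_laplace_pdf rho : measurable_fun setT (laplace_pdf rho).
Proof. by apply: continuous_measurable_fun; exact: continuous_laplace_pdf. Qed.
Hint Resolve measurable_laplace_pdf : core.

Lemma laplace_pdf_exponential rho x : 0 <= x ->
  laplace_pdf rho x = 2^-1 * exponential_pdf rho x.
Proof.
by move=> x0; rewrite exponential_pdfE// /laplace_pdf ger0_norm//; ring.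
Qed.

Lemma integral_laplace_pdf rho : 0 < rho ->
  (\int[mu]_x (laplace_pdf rho x)%:E = 1)%E.
Proof.
move=> r0; rewrite ge0_symfun_integralT; last 3 first.
- by move=> x; exact: laplace_pdf_ge0.
- exact: continuous_laplace_pdf.
- by move=> x; rewrite /laplace_pdf/= normrN.
under eq_integral.
  move=> x; rewrite inE/= => x0; rewrite laplace_pdf_exponential// EFinM.
  over.
rewrite ge0_integralZl//=; last 3 first.
- by rewrite -set_itvcy.
- by apply/measurable_EFinP/measurable_funTS; exact: measurable_exponential_pdf.
- by move=> x _; rewrite lee_fin exponential_pdf_ge0// ltW.
have -> : (\int[mu]_(x in [set x | (0 <= x)%R]) (exponential_pdf rho x)%:E = 1)%E.
  rewrite -(integral_exponential_pdf r0) integral_mkcond.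
  apply: eq_integral => x _; rewrite patchE; case: ifPn => //.
  by rewrite notin_setE/= => /negP; rewrite -ltNge => /lt0_exponential_pdf ->.
by rewrite mule1 -EFinM divff.
Qed.

Definition laplace_prob rho (r0 : 0 < rho) : set _ -> \bar R :=
  fun A => (\int[mu]_(x in A) (laplace_pdf rho x)%:E)%E.

Section instances.
Variables (rho : R) (r0 : 0 < rho).
Local Notation nu := (laplace_prob r0).

Let nu0 : nu set0 = 0%E. Proof. exact: integral_set0. Qed.

Let nu_ge0 A : (0 <= nu A)%E.
Proof. by apply: integral_ge0 => x _; rewrite lee_fin laplace_pdf_ge0. Qed.

Let nu_sigma_additive : semi_sigma_additive nu.
Proof.
move=> /= F mF tF mUF; rewrite /laplace_prob; apply: cvg_toP.
  apply: ereal_nondecreasing_is_cvgn => m n mn.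
  apply: lee_sum_nneg_natr => // k _ _; apply: integral_ge0 => /= x _.
  by rewrite lee_fin laplace_pdf_ge0.
rewrite ge0_integral_bigcup//=.
  apply: measurable_funTS; apply/measurable_EFinP.
  exact: measurable_laplace_pdf.
by move=> x _; rewrite lee_fin laplace_pdf_ge0.
Qed.

HB.instance Definition _ :=
  isMeasure.Build _ _ _ nu nu0 nu_ge0 nu_sigma_additive.

Let nu_setT : nu setT = 1%E. Proof. exact: integral_laplace_pdf. Qed.

HB.instance Definition _ := @Measure_isProbability.Build _ _ R nu nu_setT.
End instances.

Section theory.
Variables (rho : R) (r0 : 0 < rho).
Local Notation nu := (laplace_prob r0).

Lemma integral_laplace (f : R -> \bar R) :
  measurable_fun setT f -> (forall x, (0 <= f x)%E) ->
  (\int[nu]_x f x = \int[mu]_x (f x * (laplace_pdf rho x)%:E))%E.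
Proof.
move=> mf f0.
apply: (@ge0_integral_density _ _ R mu nu (laplace_pdf rho)) => //.
  exact: measurable_laplace_pdf.
by move=> x; exact: laplace_pdf_ge0.
Qed.

Lemma ge0_integral_shift (t : R) (f : R -> \bar R) :
  measurable_fun setT f -> (forall x, (0 <= f x)%E) ->
  (\int[mu]_x f (x + t)%R = \int[mu]_x f x)%E.
Proof.
move=> mf f0.
pose sh := (fun x => x + t) : measurableTypeR R -> measurableTypeR R.
have msh : measurable_fun setT sh by exact: measurable_funD.
transitivity (\int[pushforward mu sh]_x f x)%E.
  by rewrite ge0_integral_pushforward.
apply: eq_measure_integral => A mA _; apply/esym.
apply: lebesgue_measure_unique => //= _ [[a b]] _ <-.
rewrite /pushforward.
have -> : sh @^-1` `]a, b]%classic = `]a - t, b - t]%classic.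
  by apply/seteqP; split => x /=; rewrite !in_itv/= ltrBlDr lerBrDr.
by rewrite !lebesgue_measure_itv/= !lte_fin ltrD2r -!EFinB opprB addrA subrK.
Qed.

(** The square root of the ratio p (y - t) / p y for the Laplace density p;
    keeping the root explicit lets affinities be integrals of products. *)
Definition sqrt_ratio (y t : R) : R := expR (rho / 2 * (`|y| - `|y - t|)).

Lemma laplace_pdf_shift t y :
  laplace_pdf rho (y - t) = sqrt_ratio y t ^+ 2 * laplace_pdf rho y.
Proof.
rewrite /sqrt_ratio /laplace_pdf -expRM_natl mulrCA -expRD.
by congr (_ * expR _); field.
Qed.

Lemma measurable_sqrt_ratio d (U : measurableType d) (f g : U -> R) :
  measurable_fun setT f -> measurable_fun setT g ->
  measurable_fun setT (fun u => sqrt_ratio (f u) (g u)).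
Proof.
move=> mf mg.
have mn : measurable_fun (setT : set R) (fun x : R => `|x|).
  exact: normr_measurable.
apply: measurableT_comp => //; apply: measurable_funM => //.
apply: measurable_funB => //; first exact: (measurableT_comp mn).
by apply: (measurableT_comp mn); exact: measurable_funB.
Qed.

(** Change of measure for one reward: moving the noise by its mean t amounts
    to weighting it by the density ratio. *)
Lemma ge0_integral_laplace_shift (t : R) (f : R -> \bar R) :
  measurable_fun setT f -> (forall x, (0 <= f x)%E) ->
  (\int[nu]_x f (x + t)%R = \int[nu]_x (f x * (sqrt_ratio x t ^+ 2)%:E))%E.
Proof.
move=> mf f0.
have msq : measurable_fun (setT : set R) (fun x => sqrt_ratio x t ^+ 2).
  by apply: measurable_funX; exact: measurable_sqrt_ratio.
rewrite integral_laplace//; last first.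
  by apply: measurableT_comp => //; exact: measurable_funD.
rewrite integral_laplace//; last 2 first.
- by apply: emeasurable_funM => //; exact/measurable_EFinP.
- by move=> x; rewrite mule_ge0// lee_fin sqr_ge0.
rewrite -[RHS](@ge0_integral_shift t); last 2 first.
- apply: emeasurable_funM; last exact/measurable_EFinP.
  by apply: emeasurable_funM => //; exact/measurable_EFinP.
- by move=> x; rewrite !mule_ge0// lee_fin ?sqr_ge0// laplace_pdf_ge0.
apply: eq_integral => x _.
by rewrite -muleA -EFinM -laplace_pdf_shift addrK.
Qed.

Lemma laplace_probN (A : set R) : measurable A ->
  nu ((-%R : R -> R) @^-1` A) = nu A.
Proof.
move=> mA.
have mNA : measurable ((-%R : R -> R) @^-1` A).
  by rewrite -[X in measurable X]setTI; exact: oppr_measurable.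
rewrite /laplace_prob [LHS]integral_mkcond [RHS]integral_mkcond.
transitivity (\int[pushforward mu
    (-%R : measurableTypeR R -> measurableTypeR R)]_x
   ((fun x => (laplace_pdf rho x)%:E) \_ A) x)%E; last first.
  by apply: eq_measure_integral => B mB _; exact: lebesgue_measureN.
rewrite ge0_integral_pushforward//; last 2 first.
- apply/(measurable_restrictT _ mA)/measurable_funTS.
  exact/measurable_EFinP.
- by move=> x _; apply: erestrict_ge0 => y _; rewrite lee_fin laplace_pdf_ge0.
apply: eq_integral => x _ /=; rewrite !patchE.
by rewrite /laplace_pdf normrN; congr (if _ then _ else _).
Qed.

Lemma integrable_laplace : nu.-integrable setT (EFin : R -> \bar R).
Proof.
apply/integrableP; split => //.
rewrite integral_laplace//; last by apply: measurableT_comp.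
have r20 : 0 < rho / 2 by rewrite divr_gt0.
(* |x| is at most (2 / rho) * expR (rho |x| / 2), which leaves half the rate. *)
apply: (@le_lt_trans _ _
  (\int[mu]_x ((4 / rho)%:E * (laplace_pdf (rho / 2) x)%:E))%E).
  apply: ge0_le_integral => //.
  - by move=> x _; rewrite mule_ge0// lee_fin laplace_pdf_ge0.
  - apply: emeasurable_funM.
      by apply: measurableT_comp => //; exact: abse_measurable.
    by apply/measurable_EFinP; exact: measurable_laplace_pdf.
  - apply: emeasurable_funM => //; apply/measurable_EFinP.
    exact: measurable_laplace_pdf.
  - move=> x _; rewrite abse_EFin -!EFinM lee_fin /laplace_pdf.
    set u := `|x|.
    have -> : expR (- rho * u) =
        expR (- (rho / 2) * u) * expR (- (rho / 2) * u).
      by rewrite -expRD; congr expR; field.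
    rewrite !mulrA [leRHS](_ : _ = expR (- (rho / 2) * u)); last first.
      rewrite -[RHS]mul1r; congr (_ * _); field; exact: lt0r_neq0.
    rewrite ler_piMl ?expR_ge0//.
    rewrite mulNr expRN ler_pdivrMr ?expR_gt0// mul1r.
    have := expR_ge1Dx (rho / 2 * u); rewrite [u * _]mulrC; lra.
rewrite ge0_integralZl//; last 3 first.
- apply/measurable_EFinP; exact: measurable_laplace_pdf.
- by move=> x _; rewrite lee_fin laplace_pdf_ge0.
- by rewrite lee_fin divr_ge0 ?ltW.
by rewrite integral_laplace_pdf// mule1 ltry.
Qed.

Lemma integral_laplace_id : (\int[nu]_x x%:E = 0)%E.
Proof.
have iX := integrable_laplace.
have iN : nu.-integrable setT (fun x : R => (- x)%:E).
  exact: (integrableN iX).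
have E : (\int[nu]_x x%:E = \int[nu]_x (- x)%:E)%E.
  transitivity (\int[pushforward nu
    (-%R : measurableTypeR R -> measurableTypeR R)]_x x%:E)%E.
    by apply: eq_measure_integral => A mA _; exact/esym/laplace_probN.
  by rewrite integral_pushforward.
have := integrable_fin_num measurableT iX.
have EN : (\int[nu]_x (- x)%:E = - \int[nu]_x x%:E)%E.
  by rewrite -integralN//; exact: integrable_add_def.
move: E; rewrite EN.
by case: (integral _ _ _) => //= r [] ? _; congr EFin; lra.
Qed.

Lemma laplace_prob_itv0c (t : R) : 0 < t ->
  nu `]0, t] = (2^-1 * (1 - expR (- rho * t)))%:E.
Proof.
move=> t0.
have mexp D : measurable_fun D (fun x => (exponential_pdf rho x)%:E).
  by apply/measurable_funTS/measurable_EFinP; exact: measurable_exponential_pdf.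
rewrite EFinM EFinB -exponential_prob_itv0c//.
rewrite /laplace_prob /exponential_prob.
rewrite integral_itv_obnd_cbnd; last exact/measurable_funTS/measurable_EFinP.
rewrite -ge0_integralZl//=; last first.
  by move=> x _; rewrite lee_fin exponential_pdf_ge0// ltW.
  exact: mexp.
apply: eq_integral => x; rewrite inE/= in_itv/= => /andP[x0 _].
by rewrite laplace_pdf_exponential.
Qed.

Lemma laplace_prob_itvNo0 (t : R) : 0 < t ->
  nu `]- t, 0] = (2^-1 * (1 - expR (- rho * t)))%:E.
Proof.
move=> t0; rewrite -laplace_prob_itv0c// -laplace_probN//.
rewrite (_ : _ @^-1` _ = `[0, t[%classic); last first.
  apply/seteqP; split => x /=; rewrite !in_itv/=; lra.
rewrite /laplace_prob integral_itv_obnd_cbnd; last first.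
  exact/measurable_funTS/measurable_EFinP.
by rewrite integral_itv_bndo_bndc//; exact/measurable_funTS/measurable_EFinP.
Qed.

(** The distribution function is concave on the right of 0, so its slope
    condition on ]0, L] follows from the condition at L. *)
Lemma laplace_assumptionA (C L t : R) : expR (- rho * L) < 1 - 2 * C * L ->
  0 < t <= L -> C * t < 2^-1 * (1 - expR (- rho * t)).
Proof.
move=> hL /andP[t0 tL].
have L0 : 0 < L by exact: lt_le_trans tL.
pose u := t / L.
have u01 : 0 <= u <= 1.
  by rewrite divr_ge0 ?(ltW t0) ?(ltW L0)//= ler_pdivrMr ?mul1r.
have tE : t = u * L by rewrite /u divfK// gt_eqF.
have cvx : expR (- rho * t) <= u * expR (- rho * L) + (1 - u).
  have := @convex_expR R (Itv01 (proj1 (andP u01)) (proj2 (andP u01)))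
    (- rho * L) 0.
  rewrite !convRE/= expR0 mulr0 addr0 mulr1.
  by rewrite tE mulrCA.
have u0 : 0 < u by rewrite divr_gt0.
have : u * expR (- rho * L) < u * (1 - 2 * C * L) by rewrite ltr_pM2l.
have -> : C * t = u * (C * L) by rewrite tE mulrCA.
by move: cvx; clearbody u; move: (expR _) (expR _) => a b; lra.
Qed.

End theory.
End Laplace.

Section BorelR.
Context {R : realType} (m : {measure set (measurableTypeR R) -> \bar R}).

(** Lebesgue measure, hence every measure with a density against it, lives on
    a copy of R whose measurable structure carries another display;
    the same set function is a measure on R itself. *)
Definition borelR (A : set R) : \bar R := m A.

Let borelR0 : borelR set0 = 0%E. Proof. exact: measure0. Qed.
Let borelR_ge0 A : (0 <= borelR A)%E. Proof. exact: measure_ge0. Qed.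
Let borelR_sigma_additive : semi_sigma_additive borelR.
Proof. exact: (@measure_semi_sigma_additive _ _ _ m). Qed.
HB.instance Definition _ :=
  isMeasure.Build _ _ _ borelR borelR0 borelR_ge0 borelR_sigma_additive.

Let idR : measurableTypeR R -> R := id.

Let measurable_idR : measurable_fun setT idR.
Proof. by move=> _ A mA; rewrite setTI. Qed.

Lemma ge0_integral_borelR (f : R -> \bar R) :
  measurable_fun setT f -> (forall x, (0 <= f x)%E) ->
  (\int[borelR]_x f x = \int[m]_x f x)%E.
Proof.
move=> mf f0.
transitivity (\int[pushforward m idR]_x f x)%E.
  exact: eq_measure_integral.
by rewrite ge0_integral_pushforward.
Qed.

Lemma integrable_borelR (f : R -> \bar R) : measurable_fun setT f ->
  m.-integrable setT f -> borelR.-integrable setT f.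
Proof.
move=> mf /integrableP[_ foo]; apply/integrableP; split => //.
by rewrite ge0_integral_borelR//; exact: measurableT_comp.
Qed.

Lemma integral_borelR (f : R -> \bar R) :
  measurable_fun setT f -> m.-integrable setT f ->
  (\int[borelR]_x f x = \int[m]_x f x)%E.
Proof.
move=> mf fi.
transitivity (\int[pushforward m idR]_x f x)%E.
  exact: eq_measure_integral.
by rewrite integral_pushforward.
Qed.

End BorelR.

Section Noise.
Context {R : realType} (rho : R) (r0 : 0 < rho).

Definition noise : set R -> \bar R := borelR (laplace_prob r0).

HB.instance Definition _ := Measure.on noise.
Let noise_setT : noise setT = 1%E.
Proof. exact: (@probability_setT _ _ _ (laplace_prob r0)). Qed.
HB.instance Definition _ := @Measure_isProbability.Build _ _ R noise noise_setT.

Lemma noise_shift (t : R) (f : R -> \bar R) :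
  measurable_fun setT f -> (forall x, (0 <= f x)%E) ->
  (\int[noise]_x f (x + t)%R =
   \int[noise]_x (f x * (sqrt_ratio rho x t ^+ 2)%:E))%E.
Proof.
move=> mf f0.
rewrite [LHS]ge0_integral_borelR//; last first.
  by apply: measurableT_comp => //; exact: measurable_funD.
rewrite [RHS]ge0_integral_borelR//; last 2 first.
- apply: emeasurable_funM => //; apply/measurable_EFinP.
  by apply: measurable_funX; exact: measurable_sqrt_ratio.
- by move=> x; rewrite mule_ge0// lee_fin sqr_ge0.
exact: ge0_integral_laplace_shift.
Qed.

Lemma noiseN (A : set R) : measurable A ->
  noise ((-%R : R -> R) @^-1` A) = noise A.
Proof. exact: laplace_probN. Qed.

Lemma noise_integrable : noise.-integrable setT (EFin : R -> \bar R).
Proof. by apply: integrable_borelR => //; exact: integrable_laplace. Qed.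

Lemma noise_integral : (\int[noise]_x x%:E = 0)%E.
Proof.
rewrite integral_borelR//; first exact: integral_laplace_id.
exact: integrable_laplace.
Qed.

Lemma noise_itv (C L : R) : expR (- rho * L) < 1 - 2 * C * L ->
  forall t, 0 < t <= L ->
  ((C * t)%:E < noise `]0%R, t]%classic)%E /\
  ((C * t)%:E < noise `](- t)%R, 0%R]%classic)%E.
Proof.
move=> h t /[dup] tL /andP[t0 _].
by split; [rewrite [ltRHS]laplace_prob_itv0c//
          |rewrite [ltRHS]laplace_prob_itvNo0//];
  rewrite lte_fin (laplace_assumptionA h).
Qed.

End Noise.

(** * Independent rounds *)

Section Iid.
Context d (V : measurableType d) (R : realType).

Definition rectangle n (S : 'I_n -> set V) : set (n.-tuple V) :=
  [set w | forall i, S i (tnth w i)].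

Lemma measurable_rectangle n (S : 'I_n -> set V) :
  (forall i, measurable (S i)) -> measurable (rectangle S).
Proof.
move=> mS; rewrite (_ : rectangle S =
    \bigcap_(i in [set: 'I_n]) ((fun w => tnth w i) @^-1` S i)).
  apply: fin_bigcap_measurable => // i _; rewrite -[X in measurable X]setTI.
  exact: measurable_tnth.
by apply/seteqP; split => [w Sw i _|w Sw i]; apply: Sw.
Qed.

(** Rectangles are stable under intersection and generate the product
    sigma-algebra. *)
Lemma tuple_measure_unique n (m1 m2 : probability (n.-tuple V) R) :
  (forall S : 'I_n -> set V, (forall i, measurable (S i)) ->
    m1 (rectangle S) = m2 (rectangle S)) ->
  forall A, measurable A -> m1 A = m2 A.
Proof.
move=> m12.
pose G := [set A | exists2 S : 'I_n -> set V,
  (forall i, measurable (S i)) & A = rectangle S].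
apply: (measure_unique G (fun=> setT)).
- apply/seteqP; split.
    apply: smallest_sub; first exact: smallest_sigma_algebra.
    move=> A; rewrite -bigcup_seq/= => -[i _ [B mB <-]].
    apply: sub_sigma_algebra; rewrite setTI.
    exists (fun j => if j == i then B else setT).
      by move=> j; case: ifP.
    apply/seteqP; split => [w Bw j|w /(_ i)]; last by rewrite eqxx.
    by case: eqP => [->|].
  apply: smallest_sub; first exact: sigma_algebra_measurable.
  by move=> _ [S mS ->]; exact: measurable_rectangle.
- move=> _ _ [S mS ->] [S' mS' ->]; exists (fun i => S i `&` S' i).
    by move=> i; exact: measurableI.
  by apply/seteqP; split => [w [Sw Sw'] i|w Sw]; [split|split=> i; case: (Sw i)].
- by move=> _; exists (fun=> setT) => //; apply/seteqP; split.
- by rewrite bigcup_const.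
- by move=> _ [S mS ->]; exact: m12.
- by move=> _; rewrite -ge0_fin_numE// fin_num_measure.
Qed.

Section iid_def.
Variable (lam : probability V R).

Definition uncurry_cons n (p : V * n.-tuple V) : n.+1.-tuple V :=
  [tuple of p.1 :: p.2].

Lemma measurable_uncurry_cons n : measurable_fun setT (@uncurry_cons n).
Proof. exact: measurable_cons. Qed.

HB.instance Definition _ n :=
  isMeasurableFun.Build _ _ _ _ (@uncurry_cons n) (@measurable_uncurry_cons n).

Fixpoint iid n : probability (n.-tuple V) R :=
  if n is n'.+1 return probability (n.-tuple V) R
  then distribution (lam \x iid n')%E (@uncurry_cons n')
  else dirac [tuple].

Lemma iid_rectangle n (S : 'I_n -> set V) : (forall i, measurable (S i)) ->
  iid n (rectangle S) = (\prod_(i < n) lam (S i))%E.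
Proof.
elim: n S => [|n IH] S mS.
  rewrite big_ord0 /= diracE mem_set//; case=> //.
rewrite big_ord_recl /= /distribution/= /pushforward.
rewrite (_ : _ @^-1` _ = S ord0 `*` rectangle (fun i => S (lift ord0 i))).
  rewrite product_measure1E//; last exact: measurable_rectangle.
  by congr (_ * _)%E; exact: IH.
apply/seteqP; split => [[v w] /= Sw|[v w] /= [S0 Sw] i].
  split => [|i]; first exact: (Sw ord0).
  by have := Sw (lift ord0 i); rewrite tnthS.
by case: (unliftP ord0 i) => [j ->|->//]; rewrite tnthS.
Qed.

Definition upd n (i : 'I_n) (z : n.-tuple V) (v : V) : n.-tuple V :=
  [tuple (if j == i then v else tnth z j) | j < n].

Lemma tnth_upd n (i : 'I_n) z v j :
  tnth (upd i z v) j = if j == i then v else tnth z j.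
Proof. by rewrite tnth_mktuple. Qed.

Lemma measurable_upd n (i : 'I_n) d' (T : measurableType d')
    (f : T -> n.-tuple V) (g : T -> V) : measurable_fun setT f ->
  measurable_fun setT g -> measurable_fun setT (fun t => upd i (f t) (g t)).
Proof.
move=> mf mg; apply/measurable_fun_tnthP => j /=.
rewrite (_ : _ \o _ = fun t => if j == i then g t else tnth (f t) j); last first.
  by apply/funext => t /=; rewrite tnth_upd.
case: (j == i) => //.
by apply: (measurableT_comp (measurable_tnth j)).
Qed.

(** Replacing coordinate i of an i.i.d. tuple by an independent copy does not
    change its law.  Everything said below about one round given the others
    rests on this disintegration. *)
Lemma iid_resample n (i : 'I_n) (f : n.-tuple V -> \bar R) :
  measurable_fun setT f -> (forall z, (0 <= f z)%E) ->
  (\int[iid n]_z f z = \int[iid n]_z \int[lam]_v f (upd i z v))%E.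
Proof.
move=> mf f0.
pose u (p : n.-tuple V * V) := upd i p.1 p.2.
have mu : measurable_fun setT u by exact: measurable_upd.
pose um : {mfun (n.-tuple V * V)%type >-> (n.-tuple V)} :=
  HB.pack u (isMeasurableFun.Build _ _ _ _ _ mu).
transitivity (\int[distribution (iid n \x lam)%E um]_z f z)%E.
  apply: eq_measure_integral => A mA _.
  apply: tuple_measure_unique => // S mS.
  rewrite /distribution/= /pushforward.
  rewrite iid_rectangle//.
  pose S' j := if j == i then setT else S j.
  have mS' j : measurable (S' j) by rewrite /S'; case: ifP.
  rewrite [X in _ = (_ \x _)%E X](_ : _ = rectangle S' `*` S i).
    rewrite product_measure1E//; last exact: measurable_rectangle.
    rewrite (bigD1 i)//= muleC; congr (_ * _)%E.
    rewrite [RHS](iid_rectangle mS') [RHS](bigD1 i)//=.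
    rewrite {1}/S' eqxx probability_setT mul1e.
    by apply: eq_bigr => j /negPf ji; rewrite /S' ji.
  apply/seteqP; split => [[z v] /= Sz|[z v] /= [Sz Sv] j].
    split=> [j|].
      by have := Sz j; rewrite tnth_upd /S'; case: ifP.
    by have := Sz i; rewrite tnth_upd eqxx.
  by have := Sz j; rewrite tnth_upd /S'; case: eqP => [->|].
rewrite ge0_integral_pushforward//.
rewrite fubini_tonelli1//.
  exact: measurableT_comp.
by move=> x; exact: f0.
Qed.

End iid_def.
End Iid.

(** * Observed histories and their likelihood *)

Section Policy.
Context {R : realType} {T : nat}.
Notation sample := (T.-tuple (triple R)).
Variable (A : 'I_T -> sample -> bool).

(** The sets that do not separate w from w' form a sigma-algebra, which
    contains the generators as soon as w and w' have the same observations. *)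
Lemma information_atom (i : 'I_T) (w w' : sample) :
  (forall j : 'I_T, (j <= i)%N -> X_ j w = X_ j w') ->
  (forall j : 'I_T, (j < i)%N -> Y_ A j w = Y_ A j w') ->
  forall S, information A i S -> S w <-> S w'.
Proof.
move=> eX eY; pose atomic := [set S : set sample | S w <-> S w'].
suff h : information A i `<=` atomic by move=> S iS; exact: (h S iS).
apply: smallest_sub; first split.
- by [].
- move=> S; rewrite /atomic/= => SE.
  by split => -[_ nS]; split => // Sw; apply: nS; apply/SE.
- move=> F FE; split => -[n _ Fn]; exists n => //; exact/FE.
move=> S [[j /= ji] [B mB <-]|[j /= ji] [B mB <-]]; rewrite /atomic/=.
  by rewrite eX.
by rewrite eY.
Qed.

Hypothesis pA : forall i b, information A i (A i @^-1` [set b]).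

Lemma policy_nonanticipating (i : 'I_T) (w w' : sample) :
  (forall j : 'I_T, (j <= i)%N -> X_ j w = X_ j w') ->
  (forall j : 'I_T, (j < i)%N -> Y_ A j w = Y_ A j w') ->
  A i w = A i w'.
Proof.
by move=> eX eY; have [_ /(_ erefl)] := information_atom eX eY (@pA i (A i w')).
Qed.

Lemma measurable_X (i : 'I_T) : measurable_fun setT (@X_ R T i).
Proof. by apply: (measurableT_comp measurable_fst); exact: measurable_tnth. Qed.

Lemma measurable_outcome d (U : measurableType d) (f : U -> triple R)
    (a : U -> bool) : measurable_fun setT f -> measurable_fun setT a ->
  measurable_fun setT (fun u => outcome (f u) (a u)).
Proof.
move=> mf ma; rewrite /outcome.
apply: measurable_fun_ifT => //.
  by do 2!apply: (measurableT_comp measurable_snd).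
apply: (measurableT_comp measurable_fst).
exact: (measurableT_comp measurable_snd).
Qed.

(** By strong induction: the rewards that generate the information of round i
    involve earlier decisions only. *)
Lemma measurable_policy (i : 'I_T) : measurable_fun setT (A i).
Proof.
have [n] := ubnP (val i); elim: n i => // n IH i; rewrite ltnS => ni.
apply: (@measurable_fun_bool _ _ _ _ true).
rewrite setTI.
apply: (@smallest_sub _ (sigma_algebra setT) _ measurable _ _ _ (@pA i true)).
  exact: sigma_algebra_measurable.
move=> S [[j /= ji] [B mB <-]|[j /= ji] [B mB <-]].
  exact: measurable_X.
apply: measurable_outcome => //; first exact: measurable_tnth.
by apply: IH; exact: leq_trans ni.
Qed.

End Policy.

Section Game.
Context {R : realType} (rho : R) (rho0 : 0 < rho).
Local Open Scope ereal_scope.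

Definition unif01 : set R -> \bar R := borelR (uniform_prob (@ltr01 R)).
HB.instance Definition _ := Measure.on unif01.
Let unif01_setT : unif01 setT = 1%E.
Proof. exact: (@probability_setT _ _ _ (uniform_prob (@ltr01 R))). Qed.
HB.instance Definition _ := @Measure_isProbability.Build _ _ R unif01 unif01_setT.

Notation nu := (noise rho0).
Definition round_law : probability (R * R)%type R := (unif01 \x nu)%E.
Notation lam := round_law.

Notation q := (sqrt_ratio rho).

Lemma round_law_shift (t : R -> R) (f : R * R -> \bar R) :
  measurable_fun setT t -> measurable_fun setT f -> (forall v, 0 <= f v) ->
  \int[lam]_v f (v.1, v.2 + t v.1)%R =
  \int[lam]_v (f v * (q v.2 (t v.1) ^+ 2)%:E).
Proof.
move=> mt mf f0.
have mt1 : measurable_fun setT (fun v : R * R => t v.1).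
  exact: measurableT_comp.
rewrite [LHS]fubini_tonelli1//; last first.
  apply: measurableT_comp => //; apply: measurable_fun_pair => //=.
  exact: measurable_funD.
rewrite [RHS]fubini_tonelli1//; last 2 first.
- apply: emeasurable_funM => //; apply/measurable_EFinP/measurable_funX.
  exact: measurable_sqrt_ratio.
- by move=> v; rewrite mule_ge0// lee_fin sqr_ge0.
apply: eq_integral => x _; rewrite /fubini_F/=.
rewrite -(noise_shift rho0 (t x) (f := fun y => f (x, y)))//.
exact: measurableT_comp.
Qed.

Context {T : nat}.
Notation play := (T.-tuple (R * R)%type).
Notation mu := (iid lam T).
Implicit Types (i j : 'I_T) (z : play).

Lemma measurable_play1 i : measurable_fun setT (fun z : play => (tnth z i).1).
Proof. by apply: (measurableT_comp measurable_fst); exact: measurable_tnth. Qed.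
Lemma measurable_play2 i : measurable_fun setT (fun z : play => (tnth z i).2).
Proof. by apply: (measurableT_comp measurable_snd); exact: measurable_tnth. Qed.
Hint Resolve measurable_play1 measurable_play2 : core.

Lemma upd_upd i z (v v' : R * R) : upd i (upd i z v) v' = upd i z v'.
Proof. by apply: eq_from_tnth => j; rewrite !tnth_upd; case: (j == i). Qed.

(** The shift t may depend on the context of round i and on the other rounds,
    but not on the noise that it moves; with that noise resampled, t is a
    constant and the change of measure for one reward applies. *)
Lemma shift_round i (t : play -> R) (f : play -> \bar R) :
  (forall z x y y', t (upd i z (x, y)) = t (upd i z (x, y'))) ->
  measurable_fun setT t -> measurable_fun setT f -> (forall z, 0 <= f z) ->
  \int[mu]_z f (upd i z ((tnth z i).1, (tnth z i).2 + t z)%R) =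
  \int[mu]_z (f z * (q (tnth z i).2 (t z) ^+ 2)%:E).
Proof.
move=> tE mt mf f0.
rewrite [LHS](iid_resample _ i); last 2 first.
- apply: measurableT_comp => //; apply: measurable_upd => //.
  by apply: measurable_fun_pair => //; exact: measurable_funD.
- by move=> z; exact: f0.
rewrite [RHS](iid_resample _ i); last 2 first.
- apply: emeasurable_funM => //; apply/measurable_EFinP/measurable_funX.
  exact: measurable_sqrt_ratio.
- by move=> z; rewrite mule_ge0// lee_fin sqr_ge0.
apply: eq_integral => z _.
(* The dummy 0 stands for the noise, which t does not read. *)
pose tz x := t (upd i z (x, 0%R)).
transitivity (\int[lam]_v f (upd i z (v.1, v.2 + tz v.1)%R)).
  apply: eq_integral => -[x y] _.
  by rewrite upd_upd tnth_upd eqxx /tz (tE z x y 0%R).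
rewrite (round_law_shift (t := tz) (f := f \o upd i z)); last 3 first.
- apply: measurableT_comp => //; apply: measurable_upd => //.
- by apply: measurableT_comp => //; exact: measurable_upd.
- by move=> v; exact: f0.
apply: eq_integral => -[x y] _ /=.
by rewrite tnth_upd eqxx /tz (tE z x y 0%R).
Qed.

Lemma fresh_context i (f : play -> \bar R) (h : R -> \bar R) :
  (forall z v, f (upd i z v) = f z) ->
  measurable_fun setT f -> (forall z, 0 <= f z) ->
  measurable_fun setT h -> (forall x, 0 <= h x) ->
  \int[mu]_z (f z * h (tnth z i).1) = \int[mu]_z f z * \int[unif01]_x h x.
Proof.
move=> fE mf f0 mh h0.
rewrite [LHS](iid_resample _ i); last 2 first.
- by apply: emeasurable_funM => //; exact: measurableT_comp.
- by move=> z; rewrite mule_ge0.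
transitivity (\int[mu]_z (f z * \int[unif01]_x h x)); last first.
  by rewrite ge0_integralZr//; exact: integral_ge0.
apply: eq_integral => z _.
transitivity (\int[lam]_v (f z * h v.1)).
  by apply: eq_integral => v _; rewrite fE tnth_upd eqxx.
have mh1 : measurable_fun setT (fun v : R * R => h v.1).
  exact: measurableT_comp.
rewrite ge0_integralZl//; congr (_ * _).
rewrite fubini_tonelli1//; apply: eq_integral => x _.
by rewrite /fubini_F/= integral_cst// [X in _ * X]probability_setT mule1.
Qed.

(** The density ratio of a reward integrates to 1, whatever the context and
    the past: only the context of round i is seen by h. *)
Lemma fresh_round i (t : play -> R) (f : play -> \bar R) (h : R -> \bar R) :
  (forall z x y y', t (upd i z (x, y)) = t (upd i z (x, y'))) ->
  measurable_fun setT t ->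
  (forall z v, f (upd i z v) = f z) ->
  measurable_fun setT f -> (forall z, 0 <= f z) ->
  measurable_fun setT h -> (forall x, 0 <= h x) ->
  \int[mu]_z (f z * h (tnth z i).1 * (q (tnth z i).2 (t z) ^+ 2)%:E) =
  \int[mu]_z f z * \int[unif01]_x h x.
Proof.
move=> tE mt fE mf f0 mh h0.
rewrite -(shift_round tE mt (f := fun z => f z * h (tnth z i).1)); last 2 first.
- by apply: emeasurable_funM => //; exact: measurableT_comp.
- by move=> z; rewrite mule_ge0.
rewrite -(fresh_context fE)//; apply: eq_integral => z _.
by rewrite fE tnth_upd eqxx.
Qed.

Definition nonanticipating (a : 'I_T -> play -> bool) := forall i z z',
  (forall j, (j <= i)%N -> (tnth z j).1 = (tnth z' j).1) ->
  (forall j, (j < i)%N -> (tnth z j).2 = (tnth z' j).2) ->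
  a i z = a i z'.

Section Run.
Variable a : 'I_T -> play -> bool.
Hypothesis aE : nonanticipating a.
Hypothesis ma : forall i, measurable_fun setT (a i).

Definition mean (F : bool -> R -> R) i z : R := F (a i z) (tnth z i).1.

(** The square root of the density, with respect to the i.i.d. law of
    contexts and noises, of the history of the first m rounds. *)
Definition sqrt_lik F (m : nat) z : R :=
  (\prod_(j < T | (j < m)%N) q (tnth z j).2 (mean F j z))%R.

Variable F : bool -> R -> R.
Hypothesis mF : forall b, measurable_fun setT (F b).

Lemma measurable_mean i : measurable_fun setT (mean F i).
Proof.
rewrite (_ : mean F i = fun z => if a i z then F true (tnth z i).1
                               else F false (tnth z i).1); last first.
  by apply/funext => z; rewrite /mean; case: (a i z).
by apply: measurable_fun_ifT => //; exact: measurableT_comp.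
Qed.

Lemma sqrt_lik_ge0 m z : (0 <= sqrt_lik F m z)%R.
Proof. by apply: prodr_ge0 => j _; exact: expR_ge0. Qed.

Lemma measurable_sqrt_lik m : measurable_fun setT (sqrt_lik F m).
Proof.
rewrite /sqrt_lik.
under eq_fun do rewrite big_mkcond.
apply: measurable_prod => j _; case: (j < m)%N => //.
by apply: measurable_sqrt_ratio => //; exact: measurable_mean.
Qed.

Lemma sqrt_lik0 z : sqrt_lik F 0 z = 1%R.
Proof. by rewrite /sqrt_lik big_pred0. Qed.

Lemma sqrt_likS i z :
  sqrt_lik F i.+1 z = (sqrt_lik F i z * q (tnth z i).2 (mean F i z))%R.
Proof.
rewrite /sqrt_lik (bigD1 i) ?ltnSn//= mulrC; congr (_ * _)%R.
by apply: eq_bigl => j; rewrite ltnS ltn_neqAle andbC.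
Qed.

Lemma mean_upd i z x y y' :
  mean F i (upd i z (x, y)) = mean F i (upd i z (x, y')).
Proof.
rewrite /mean !tnth_upd eqxx/=; congr (F _ _).
by apply: aE => j ji; rewrite !tnth_upd; case: eqP ji => // ->; rewrite ?ltnn.
Qed.

Lemma mean_upd_lt i j z v : (j < i)%N -> mean F j (upd i z v) = mean F j z.
Proof.
move=> ji; have ne (k : 'I_T) : (k <= j)%N -> (k == i) = false.
  by move=> kj; apply/negbTE; rewrite -val_eqE/= neq_ltn (leq_ltn_trans kj).
rewrite /mean !tnth_upd ne//; congr (F _ _).
apply: aE => k kj; rewrite tnth_upd ne//; exact: ltnW.
Qed.

Lemma sqrt_lik_upd i z v : sqrt_lik F i (upd i z v) = sqrt_lik F i z.
Proof.
apply: eq_bigr => j ji; rewrite mean_upd_lt// tnth_upd.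
by case: eqP ji => // ->; rewrite ltnn.
Qed.

End Run.

Section Observed.
Notation sample := (T.-tuple (triple R)).
Variable A : 'I_T -> sample -> bool.
Hypothesis pA : forall i b, information A i (A i @^-1` [set b]).
Variable F : bool -> R -> R.
Hypothesis mF : forall b, measurable_fun setT (F b).

(** A fictitious sample in which the observed reward is the outcome of either
    arm: the policy plays on it as on any sample with that history. *)
Definition both_outcomes (z : play) : sample :=
  [tuple ((tnth z j).1, ((tnth z j).2, (tnth z j).2)) | j < T].

Definition arm i z := A i (both_outcomes z).

Definition world z : sample :=
  [tuple ((tnth z j).1, (F false (tnth z j).1 + (tnth z j).2,
                         F true (tnth z j).1 + (tnth z j).2))%R | j < T].

(** Interpolates between the noises (m = 0) and the observed rewards (m = T), so
    that the law of the history is reached one round at a time. *)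
Definition observed (m : nat) z : play :=
  [tuple (if (j < m)%N then ((tnth z j).1, Y_ A j (world z)) else tnth z j)
  | j < T].

Lemma arm_nonanticipating : nonanticipating arm.
Proof.
move=> i z z' e1 e2; apply: policy_nonanticipating => // j ji.
  by rewrite /X_ !tnth_mktuple/= e1.
by rewrite /Y_ /outcome !tnth_mktuple/= e2// !if_same.
Qed.

Lemma measurable_both_outcomes : measurable_fun setT both_outcomes.
Proof.
apply/measurable_fun_tnthP => j.
rewrite (_ : _ \o _ = fun z => ((tnth z j).1, ((tnth z j).2, (tnth z j).2))).
  by apply: measurable_fun_pair => //; exact: measurable_fun_pair.
by apply/funext => z /=; rewrite tnth_mktuple.
Qed.

Lemma measurable_world : measurable_fun setT world.
Proof.
apply/measurable_fun_tnthP => j.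
rewrite (_ : _ \o _ = fun z => ((tnth z j).1,
    (F false (tnth z j).1 + (tnth z j).2, F true (tnth z j).1 + (tnth z j).2))%R).
  apply: measurable_fun_pair => //; apply: measurable_fun_pair => //;
  by apply: measurable_funD => //; exact: measurableT_comp.
by apply/funext => z /=; rewrite tnth_mktuple.
Qed.

Lemma measurable_arm i : measurable_fun setT (arm i).
Proof.
apply: measurableT_comp; first exact: measurable_policy.
exact: measurable_both_outcomes.
Qed.

Lemma Y_world i z :
  Y_ A i (world z) = (F (A i (world z)) (tnth z i).1 + (tnth z i).2)%R.
Proof. by rewrite {1}/Y_ /outcome tnth_mktuple/=; case: (A i _). Qed.

Lemma observed1 m z i : (tnth (observed m z) i).1 = (tnth z i).1.
Proof. by rewrite tnth_mktuple; case: ifP. Qed.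

(** Both samples have the same contexts, and the same observed rewards in the
    rounds before i. *)
Lemma arm_observed i z : arm i (observed i z) = A i (world z).
Proof.
apply: policy_nonanticipating => // j ji.
  by rewrite /X_ !tnth_mktuple/=; case: ifP.
by rewrite {1}/Y_ /outcome !tnth_mktuple/= ji if_same.
Qed.

Lemma observedS i z : observed i.+1 z =
  upd i (observed i z) ((tnth (observed i z) i).1,
    (tnth (observed i z) i).2 + mean arm F i (observed i z))%R.
Proof.
apply: eq_from_tnth => j; rewrite tnth_upd.
have [->|ji] := eqVneq j i; last first.
  by rewrite !tnth_mktuple ltnS leq_eqVlt val_eqE (negbTE ji).
rewrite /mean arm_observed observed1 tnth_mktuple ltnSn Y_world.
by rewrite [tnth (observed _ _) _]tnth_mktuple ltnn addrC.
Qed.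

(** Induction on m: by observedS, the history gets its next reward through
    the shift of one noise, whose ratio completes the likelihood. *)
Lemma integral_observed m (g : play -> \bar R) : (m <= T)%N ->
  measurable_fun setT g -> (forall z, 0 <= g z) ->
  \int[mu]_z g (observed m z) =
  \int[mu]_z (g z * (sqrt_lik arm F m z ^+ 2)%:E).
Proof.
have marm := measurable_arm.
elim: m g => [|m IH] g mT mg g0.
  apply: eq_integral => z _; rewrite sqrt_lik0 expr1n mule1; congr g.
  by apply: eq_from_tnth => j; rewrite tnth_mktuple.
pose i := Ordinal mT.
pose G z := g (upd i z ((tnth z i).1, (tnth z i).2 + mean arm F i z)%R).
have mmean : measurable_fun setT (mean arm F i) by exact: measurable_mean.
have mlik := measurable_sqrt_lik marm mF i.
transitivity (\int[mu]_z G (observed m z)).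
  by apply: eq_integral => z _; rewrite (observedS i z).
have mG : measurable_fun setT G.
  apply: measurableT_comp => //; apply: measurable_upd => //.
  by apply: measurable_fun_pair => //; exact: measurable_funD.
rewrite IH ?(ltnW mT)//; last by move=> z; exact: g0.
transitivity (\int[mu]_z (g z * (sqrt_lik arm F m z ^+ 2)%:E *
    (q (tnth z i).2 (mean arm F i z) ^+ 2)%:E)); last first.
  apply: eq_integral => z _.
  by rewrite (sqrt_likS _ _ i z) exprMn -muleA -EFinM.
rewrite -(shift_round (i := i) (t := mean arm F i)
  (f := fun z => g z * (sqrt_lik arm F m z ^+ 2)%:E))//.
- apply: eq_integral => z _; rewrite /G; congr (_ * (_ ^+ 2)%:E).
  by rewrite (sqrt_lik_upd arm_nonanticipating F i).
- by move=> z x y y'; exact: mean_upd arm_nonanticipating _ _ _ _ _ _.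
- by apply: emeasurable_funM => //; apply/measurable_EFinP/measurable_funX.
- by move=> z; rewrite mule_ge0// lee_fin sqr_ge0.
Qed.

End Observed.
End Game.

(** * Two sign vectors that differ on one bin *)

(** The two roots differ by a factor expR s with |s| <= rho * d / 2, by the
    triangle inequality; the last term bounds half the square of their
    difference. *)
Lemma sqrt_ratio_close (R : realType) (rho d y t t' : R) : 0 < rho ->
  `|t - t'| <= d -> rho * d <= 1 ->
  2^-1 * sqrt_ratio rho y t ^+ 2 + 2^-1 * sqrt_ratio rho y t' ^+ 2 <=
  sqrt_ratio rho y t * sqrt_ratio rho y t' +
  (rho * d) ^+ 2 / 2 * sqrt_ratio rho y t ^+ 2.
Proof.
move=> r0 td rd; set h := rho * d / 2.
pose s := rho / 2 * (`|y - t| - `|y - t'|).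
have -> : sqrt_ratio rho y t' = sqrt_ratio rho y t * expR s.
  by rewrite /sqrt_ratio -expRD; congr expR; rewrite /s; ring.
have d0 : 0 <= d by apply: le_trans td.
have h0 : 0 <= h by rewrite divr_ge0// mulr_ge0// ltW.
have sh : `|s| <= h.
  rewrite /s /h normrM gtr0_norm ?divr_gt0// [leRHS]mulrAC ler_pM2l ?divr_gt0//.
  apply: le_trans td; rewrite (distrC t).
  apply: le_trans (ler_dist_dist _ _) _; rewrite le_eqVlt; apply/orP; left.
  by apply/eqP; congr `|_|; ring.
have [s1 s2] : - h <= s /\ s <= h by apply/andP; rewrite -ler_norml.
have h12 : h <= 2^-1 by rewrite /h ler_pdivrMr// mulVf.
have lo : 1 - h <= expR s by apply: le_trans (expR_ge1Dx s); lra.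
have up : expR s <= 1 + 2 * h.
  have e0 : 0 < expR s := expR_gt0 s.
  have := expR_ge1Dx (- s); rewrite expRN => e1.
  have : (1 - h) * expR s <= 1.
    rewrite -ler_pdivlMr// mul1r; apply: le_trans e1; lra.
  nra.
set r := expR s in lo up *; set u := sqrt_ratio _ _ _.
have : (r - 1) ^+ 2 <= (2 * h) ^+ 2.
  have : 0 <= (2 * h - (r - 1)) * (2 * h + (r - 1)) by apply: mulr_ge0; lra.
  lra.
have -> : rho * d = 2 * h by rewrite /h; field.
move: (sqr_ge0 u); set u2 := u ^+ 2 => u20 hr.
have : u2 * (r - 1) ^+ 2 <= u2 * (2 * h) ^+ 2 by rewrite ler_wpM2l.
have -> : u * (u * r) = u2 * r by rewrite /u2; ring.
have -> : (u * r) ^+ 2 = u2 * r ^+ 2 by rewrite /u2 exprMn.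
by rewrite -/u2; lra.
Qed.

Lemma ge0_integral_comb d (U : measurableType d) (R : realType)
    (m : {measure set U -> \bar R}) (c c' : R) (f g : U -> R) :
  0 <= c -> 0 <= c' -> measurable_fun setT f -> measurable_fun setT g ->
  (forall x, 0 <= f x) -> (forall x, 0 <= g x) ->
  (\int[m]_x (c * f x + c' * g x)%:E =
   c%:E * \int[m]_x (f x)%:E + c'%:E * \int[m]_x (g x)%:E)%E.
Proof.
move=> c0 c'0 mf mg f0 g0.
have mfE : measurable_fun setT (EFin \o f) by exact/measurable_EFinP.
have mgE : measurable_fun setT (EFin \o g) by exact/measurable_EFinP.
rewrite -ge0_integralZl_EFin//; last by move=> x _; rewrite lee_fin.
rewrite -ge0_integralZl_EFin//; last by move=> x _; rewrite lee_fin.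
rewrite -ge0_integralD//.
- by move=> x _; rewrite mule_ge0// lee_fin.
- exact: measurable_funeM.
- by move=> x _; rewrite mule_ge0// lee_fin.
- exact: measurable_funeM.
Qed.

Section TwoPoint.
Context {R : realType} (rho : R) (rho0 : 0 < rho) {T : nat}.
Local Open Scope ereal_scope.
Notation play := (T.-tuple (R * R)%type).
Notation mu := (iid (round_law rho0) T).
Notation q := (sqrt_ratio rho).
Implicit Types (i j : 'I_T) (z : play).
Variable a : 'I_T -> play -> bool.
Hypothesis aE : nonanticipating a.
Hypothesis ma : forall i, measurable_fun setT (a i).
Hint Resolve measurable_play1 measurable_play2 : core.

Let measurable_q (F : bool -> R -> R) i : (forall b, measurable_fun setT (F b)) ->
  measurable_fun setT (fun z => q (tnth z i).2 (mean a F i z)).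
Proof.
move=> mF; apply: measurable_sqrt_ratio; first exact: measurable_play2.
exact: (measurable_mean ma mF).
Qed.

Lemma integral_lik (F : bool -> R -> R) m :
  (forall b, measurable_fun setT (F b)) -> (m <= T)%N ->
  \int[mu]_z (sqrt_lik rho a F m z ^+ 2)%:E = 1.
Proof.
move=> mF; elim: m => [|m IH] mT.
  under eq_integral do rewrite sqrt_lik0 expr1n.
  by rewrite integral_cst// [X in _ * X]probability_setT mule1.
pose i := Ordinal mT.
transitivity (\int[mu]_z ((sqrt_lik rho a F m z ^+ 2)%:E * 1%E *
    (q (tnth z i).2 (mean a F i z) ^+ 2)%:E)).
  by apply: eq_integral => z _; rewrite mule1 (sqrt_likS _ _ _ i z) exprMn.
rewrite (@fresh_round _ _ _ _ i _ _ (fun=> 1%E))//.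
- rewrite (IH (ltnW mT)) integral_cst//.
  by rewrite [X in _ * (_ * X)]probability_setT !mul1e.
- by move=> z x y y'; exact: mean_upd.
- exact: measurable_mean.
- by move=> z v; rewrite (sqrt_lik_upd rho aE F i).
- by apply/measurable_EFinP/measurable_funX; exact: measurable_sqrt_lik.
- by move=> z; rewrite lee_fin sqr_ge0.
Qed.

Variables F F' : bool -> R -> R.
Hypotheses (mF : forall b, measurable_fun setT (F b))
  (mF' : forall b, measurable_fun setT (F' b)).
Variables (B : set R) (d p : R).
Hypotheses (mB : measurable B) (pE : unif01 B = p%:E).
Hypothesis FF' : forall b x, ~ B x -> F b x = F' b x.
Hypothesis FdF' : forall b x, (`|F b x - F' b x| <= d)%R.
Hypothesis rd : (rho * d <= 1)%R.

Notation M := (sqrt_lik rho a F).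
Notation M' := (sqrt_lik rho a F').
Notation K := ((rho * d) ^+ 2 / 2)%R.

Let mM m : measurable_fun setT (M m). Proof. exact: measurable_sqrt_lik. Qed.
Let mM' m : measurable_fun setT (M' m). Proof. exact: measurable_sqrt_lik. Qed.
Let M0 m z : (0 <= M m z)%R. Proof. exact: sqrt_lik_ge0. Qed.
Let M'0 m z : (0 <= M' m z)%R. Proof. exact: sqrt_lik_ge0. Qed.
Let mMM' m : measurable_fun setT (fun z => M m z * M' m z)%R.
Proof. exact: measurable_funM. Qed.
Let K0 : (0 <= K)%R. Proof. by rewrite divr_ge0 ?sqr_ge0. Qed.
Let p0 : (0 <= p)%R. Proof. by rewrite -lee_fin -pE. Qed.
Let mBR : measurable_fun setT (\1_B : R -> R).
Proof. exact: measurable_indic. Qed.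

(** The Hellinger affinity of the two laws of the first m rounds. *)
Definition affinity m := \int[mu]_z (M m z * M' m z)%:E.

Lemma affinity_le1 m : (m <= T)%N -> affinity m <= 1.
Proof.
move=> mT; pose g z := (2^-1 * M m z ^+ 2 + 2^-1 * M' m z ^+ 2)%R.
have -> : 1 = \int[mu]_z (g z)%:E.
  rewrite ge0_integral_comb//; last 4 first.
  - exact: measurable_funX.
  - exact: measurable_funX.
  - by move=> z; rewrite sqr_ge0.
  - by move=> z; rewrite sqr_ge0.
  by rewrite !integral_lik// !mule1 -EFinD; congr EFin; field.
apply: ge0_le_integral => //.
- by move=> z _; rewrite lee_fin mulr_ge0.
- exact/measurable_EFinP.
- apply/measurable_EFinP/measurable_funD; apply: measurable_funM => //;
  exact: measurable_funX.
- by move=> z _; rewrite lee_fin /g; have := sqr_ge0 (M m z - M' m z)%R; lra.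
Qed.

(** Outside B the two ratios of the reward coincide and the half sum of their
    squares equals their product.  Inside B the product loses at most
    K times the first square.  The half sum integrates to the current
    affinity, and B has probability p independently of the past. *)
Lemma affinity_step i : affinity i <= affinity i.+1 + (K * p)%:E.
Proof.
pose f z := (M i z * M' i z)%R.
have f0 z : (0 <= f z)%R by rewrite mulr_ge0.
have mf : measurable_fun setT f by exact: mMM'.
pose qi z := q (tnth z i).2 (mean a F i z).
pose qi' z := q (tnth z i).2 (mean a F' i z).
have q0 z : (0 <= qi z)%R by exact: expR_ge0.
have q'0 z : (0 <= qi' z)%R by exact: expR_ge0.
have mq : measurable_fun setT qi by exact: measurable_q.
have mq' : measurable_fun setT qi' by exact: measurable_q.
have fE z v : f (upd i z v) = f z.
  by rewrite /f !(sqrt_lik_upd rho aE _ i).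
have mfq2 : measurable_fun setT (fun z => f z * qi z ^+ 2)%R.
  by apply: measurable_funM => //; exact: measurable_funX.
have mfq'2 : measurable_fun setT (fun z => f z * qi' z ^+ 2)%R.
  by apply: measurable_funM => //; exact: measurable_funX.
have mfqq : measurable_fun setT (fun z => f z * (qi z * qi' z))%R.
  by apply: measurable_funM => //; exact: measurable_funM.
have mfB : measurable_fun setT (fun z => f z * \1_B (tnth z i).1 * qi z ^+ 2)%R.
  apply: measurable_funM; last exact: measurable_funX.
  apply: measurable_funM => //; apply: (measurableT_comp mBR).
  exact: measurable_play1.
have I1 G : (forall b, measurable_fun setT (G b)) ->
    \int[mu]_z (f z * q (tnth z i).2 (mean a G i z) ^+ 2)%:E = affinity i.
  move=> mG; transitivity (\int[mu]_z ((f z)%:E * 1%E *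
      (q (tnth z i).2 (mean a G i z) ^+ 2)%:E)).
    by apply: eq_integral => z _; rewrite mule1 EFinM.
  rewrite (@fresh_round _ _ _ _ i _ _ (fun=> 1%E))//.
  - by rewrite integral_cst// [X in _ * (_ * X)]probability_setT !mule1.
  - by move=> z x y y'; exact: mean_upd.
  - exact: measurable_mean.
  - by move=> z v; rewrite fE.
  - exact/measurable_EFinP.
have I2 : \int[mu]_z (f z * \1_B (tnth z i).1 * qi z ^+ 2)%:E = affinity i * p%:E.
  transitivity (\int[mu]_z ((f z)%:E * (\1_B (tnth z i).1)%:E *
      (q (tnth z i).2 (mean a F i z) ^+ 2)%:E)).
    by apply: eq_integral => z _; rewrite !EFinM.
  rewrite (@fresh_round _ _ _ _ i _ _ (fun x => (\1_B x)%:E))//.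
  - by congr (_ * _); rewrite integral_indic// setIT; exact: pE.
  - by move=> z x y y'; exact: mean_upd.
  - exact: measurable_mean.
  - by move=> z v; rewrite fE.
  - exact/measurable_EFinP.
  - exact/measurable_EFinP.
have -> : affinity i = \int[mu]_z (2^-1 * (f z * qi z ^+ 2) +
                                   2^-1 * (f z * qi' z ^+ 2))%:E.
  rewrite ge0_integral_comb//; last 2 first.
  - by move=> z; rewrite mulr_ge0// sqr_ge0.
  - by move=> z; rewrite mulr_ge0// sqr_ge0.
  rewrite !I1// -ge0_muleDl// -EFinD (_ : 2^-1 + 2^-1 = 1)%R ?mul1e//; lra.
apply: (@le_trans _ _ (\int[mu]_z (1 * (f z * (qi z * qi' z)) +
    K * (f z * \1_B (tnth z i).1 * qi z ^+ 2))%:E)).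
  apply: ge0_le_integral => //.
  - by move=> z _; rewrite lee_fin addr_ge0// !mulr_ge0// sqr_ge0.
  - by apply/measurable_EFinP/measurable_funD; exact: measurable_funM.
  - by apply/measurable_EFinP/measurable_funD; exact: measurable_funM.
  - move=> z _; rewrite lee_fin mul1r.
    have -> : (2^-1 * (f z * qi z ^+ 2) + 2^-1 * (f z * qi' z ^+ 2) =
       f z * (2^-1 * qi z ^+ 2 + 2^-1 * qi' z ^+ 2))%R by ring.
    have -> : (f z * (qi z * qi' z) + K * (f z * \1_B (tnth z i).1 * qi z ^+ 2) =
       f z * (qi z * qi' z + \1_B (tnth z i).1 * (K * qi z ^+ 2)))%R by ring.
    rewrite ler_wpM2l// indicE.
    have [zB|zB] := boolP ((tnth z i).1 \in B).
      rewrite mul1r; apply: sqrt_ratio_close => //; exact: FdF'.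
    rewrite mul0r addr0 /qi /qi' /mean FF'; last first.
      by move/mem_set; apply/negP.
    lra.
rewrite ge0_integral_comb//; last 2 first.
- by move=> z; rewrite !mulr_ge0.
- by move=> z; rewrite !mulr_ge0// sqr_ge0.
rewrite mul1e I2; apply: leeD.
  rewrite le_eqVlt; apply/orP; left; apply/eqP; apply: eq_integral => z _.
  by rewrite /f (sqrt_likS _ _ F i) (sqrt_likS _ _ F' i) mulrACA.
rewrite [leRHS]EFinM; apply: lee_wpmul2l; first by rewrite lee_fin.
rewrite -[leRHS]mul1e; apply: lee_wpmul2r; first by rewrite lee_fin.
by apply: affinity_le1; exact: ltnW.
Qed.

Lemma affinity_lower m : (m <= T)%N -> 1 <= affinity m + (m%:R * (K * p))%:E.
Proof.
elim: m => [_|m IH mT].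
  rewrite mul0r adde0 /affinity.
  under eq_integral do rewrite !sqrt_lik0 mulr1.
  by rewrite integral_cst// [X in _ * X]probability_setT mule1.
apply: le_trans (IH (ltnW mT)) _.
have -> : (m.+1%:R * (K * p) = K * p + m%:R * (K * p))%R.
  by rewrite -natr1 mulrDl mul1r addrC.
by rewrite EFinD addeA; apply: leeD2r; exact: (affinity_step (Ordinal mT)).
Qed.

(** No decision rule is good under both hypotheses.  On the event that the
    context falls in B, the two error densities add up to at least
    min(M^2, M'^2) >= M M' - (M^2 + M'^2) / 4, and the past is independent of
    that event, so that the integral is at least p (3/4 - 1/2). *)
Lemma two_point i (b : bool) : (T%:R * (K * p) <= 4^-1)%R ->
  (p / 4)%:E <=
  \int[mu]_z (\1_B (tnth z i).1 * (a i z == b)%:R * M i z ^+ 2)%:E +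
  \int[mu]_z (\1_B (tnth z i).1 * (a i z != b)%:R * M' i z ^+ 2)%:E.
Proof.
move=> TK.
have iT : (i <= T)%N by exact: ltnW.
have mB1 : measurable_fun setT (fun z => \1_B (tnth z i).1 : R).
  by apply: (measurableT_comp mBR); exact: measurable_play1.
have mab (e : bool) : measurable_fun setT (fun z => ((a i z == b) == e)%:R : R).
  rewrite (_ : (fun z => _) = (fun z => if a i z then ((true == b) == e)%:R
                                        else ((false == b) == e)%:R)).
    by apply: measurable_fun_ifT => //; exact: ma.
  by apply/funext => z; case: (a i z).
have mM2 : measurable_fun setT (fun z => M i z ^+ 2)%R by exact: measurable_funX.
have mM'2 : measurable_fun setT (fun z => M' i z ^+ 2)%R by exact: measurable_funX.
pose g1 z := (\1_B (tnth z i).1 * (a i z == b)%:R * M i z ^+ 2)%R.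
pose g2 z := (\1_B (tnth z i).1 * (a i z != b)%:R * M' i z ^+ 2)%R.
have g10 z : (0 <= g1 z)%R by rewrite !mulr_ge0// sqr_ge0.
have g20 z : (0 <= g2 z)%R by rewrite !mulr_ge0// sqr_ge0.
have mg1 : measurable_fun setT g1.
  apply: measurable_funM => //; apply: measurable_funM => //.
  by have := mab true; under eq_fun do rewrite eqb_id.
have mg2 : measurable_fun setT g2.
  apply: measurable_funM => //; apply: measurable_funM => //.
  by have := mab false; under eq_fun do rewrite eqbF_neg.
have restrict (f : play -> R) : measurable_fun setT f -> (forall z, 0 <= f z)%R ->
    (forall z v, f (upd i z v) = f z) ->
    \int[mu]_z (\1_B (tnth z i).1 * f z)%:E = \int[mu]_z (f z)%:E * p%:E.
  move=> mf f0 fE.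
  transitivity (\int[mu]_z ((f z)%:E * (\1_B (tnth z i).1)%:E)).
    by apply: eq_integral => z _; rewrite mulrC EFinM.
  rewrite (@fresh_context _ _ _ _ i _ (fun x => (\1_B x)%:E))//.
  - by congr (_ * _); rewrite integral_indic// setIT; exact: pE.
  - by move=> z v; rewrite fE.
  - exact/measurable_EFinP.
  - exact/measurable_EFinP.
have updM z v : M i (upd i z v) = M i z by exact: (sqrt_lik_upd rho aE F i).
have updM' z v : M' i (upd i z v) = M' i z by exact: (sqrt_lik_upd rho aE F' i).
set I1 := \int[mu]_z _; set I2 := \int[mu]_z _.
have main : affinity i * p%:E <= I1 + I2 + (p / 2)%:E.
  rewrite -(restrict (fun z => M i z * M' i z)%R)//; last 2 first.
  - by move=> z; rewrite mulr_ge0.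
  - by move=> z v; rewrite updM updM'.
  have -> : I1 + I2 + (p / 2)%:E = \int[mu]_z (1 * (1 * g1 z + 1 * g2 z) +
     4^-1 * (\1_B (tnth z i).1 * (1 * M i z ^+ 2 + 1 * M' i z ^+ 2)))%:E.
    rewrite ge0_integral_comb//; last 4 first.
    - by apply: measurable_funD; exact: measurable_funM.
    - apply: measurable_funM => //; apply: measurable_funD; exact: measurable_funM.
    - by move=> z; rewrite addr_ge0// mulr_ge0.
    - by move=> z; rewrite mulr_ge0// addr_ge0// mulr_ge0// sqr_ge0.
    rewrite ge0_integral_comb// !mul1e; congr (_ + _).
    rewrite restrict; last 3 first.
    - by apply: measurable_funD; exact: measurable_funM.
    - by move=> z; rewrite addr_ge0// mulr_ge0// sqr_ge0.
    - by move=> z v; rewrite updM updM'.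
    rewrite ge0_integral_comb//; last 2 first.
    - by move=> z; rewrite sqr_ge0.
    - by move=> z; rewrite sqr_ge0.
    by rewrite !integral_lik// -!EFinM; congr EFin; field.
  apply: ge0_le_integral => //.
  - by move=> z _; rewrite lee_fin !mulr_ge0.
  - by apply/measurable_EFinP; exact: measurable_funM.
  - apply/measurable_EFinP; apply: measurable_funD; apply: measurable_funM => //.
      by apply: measurable_funD; exact: measurable_funM.
    by apply: measurable_funM => //; apply: measurable_funD; exact: measurable_funM.
  - move=> z _; rewrite lee_fin !mul1r /g1 /g2.
    have B0 : (0 <= \1_B (tnth z i).1 :> R)%R by [].
    set x := M i z; set y := M' i z; set c := \1_B _ in B0 *.
    have x0 : (0 <= x)%R := M0 i z; have y0 : (0 <= y)%R := M'0 i z.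
    suff h : (x * y <= (a i z == b)%:R * x ^+ 2 + (a i z != b)%:R * y ^+ 2 +
        4^-1 * (x ^+ 2 + y ^+ 2))%R by have := ler_wpM2l B0 h; lra.
    case: (a i z == b) => /=; rewrite ?mul1r ?mul0r ?addr0 ?add0r.
      by have := sqr_ge0 (2 * x - y)%R; have := sqr_ge0 x; lra.
    by have := sqr_ge0 (2 * y - x)%R; have := sqr_ge0 y; lra.
have := affinity_lower iT.
have := affinity_le1 iT.
have : 0 <= affinity i by apply: integral_ge0 => z _; rewrite lee_fin mulr_ge0.
have I10 : 0 <= I1 by apply: integral_ge0 => z _; exact: g10.
have I20 : 0 <= I2 by apply: integral_ge0 => z _; exact: g20.
have : (i%:R * (K * p) <= 4^-1)%R.
  apply: le_trans TK; rewrite ler_wpM2r ?ler_nat//.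
  exact: mulr_ge0.
have : 0 <= I1 + I2 by rewrite adde_ge0.
move: main; case: (affinity i) => [c| |]//.
case: (I1 + I2) => [r| |]// main _ iK _ _.
  rewrite -EFinD lee_fin => c1; move: main.
  rewrite -EFinM -EFinD !lee_fin => main.
  have : (3 / 4 <= c)%R by lra.
  move=> /(ler_wpM2r p0); lra.
by rewrite leey.
Qed.

End TwoPoint.

(** * Laws of the bandit model and their regret *)

Section Law.
Context {R : realType} (rho : R) (rho0 : 0 < rho).
Notation nu := (noise rho0).
Notation lam := (round_law rho0).

Lemma noise_marginal d (U : measurableType d) (m : probability U R)
    (f : {mfun U >-> R}) :
  (forall A, measurable A -> m (f @^-1` A) = nu A) ->
  m.-integrable setT (EFin \o f) /\ (\int[m]_u (f u)%:E = 0)%E.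
Proof.
move=> fE.
have dE (g : R -> \bar R) : (\int[distribution m f]_x g x = \int[nu]_x g x)%E.
  by apply: eq_measure_integral => A mA _; exact: fE.
have mf : measurable_fun setT (EFin \o f) by exact/measurable_EFinP.
have fi : m.-integrable setT (EFin \o f).
  apply/integrableP; split => //.
  have /integrableP[_] := noise_integrable rho0.
  rewrite -dE ge0_integral_distribution//; exact: measurableT_comp.
split => //; rewrite -(noise_integral rho0) -dE.
by rewrite (@integral_distribution _ _ _ _ _ m f EFin).
Qed.

Variable F : bool -> R -> R.
Hypothesis mF : forall b, measurable_fun setT (F b).

Definition triple_of (v : R * R) : triple R :=
  (v.1, (F false v.1 + v.2, F true v.1 + v.2)).

Lemma measurable_triple_of : measurable_fun setT triple_of.
Proof.
have m1 b : measurable_fun setT (fun v : R * R => F b v.1).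
  exact: measurableT_comp.
by apply: measurable_fun_pair => //; apply: measurable_fun_pair;
  exact: measurable_funD.
Qed.

HB.instance Definition _ := isMeasurableFun.Build _ _ _ _ _ measurable_triple_of.

Definition triple_law : probability (triple R) R := distribution lam triple_of.

(** The noise, recovered from the outcome of arm 0. *)
Definition residual (z : triple R) : R := z.2.1 - F false z.1.

Lemma measurable_residual : measurable_fun setT residual.
Proof.
apply: measurable_funB; last exact: measurableT_comp.
by apply: (measurableT_comp measurable_fst).
Qed.

HB.instance Definition _ := isMeasurableFun.Build _ _ _ _ _ measurable_residual.

Lemma residual_triple_of v : residual (triple_of v) = v.2.
Proof. by rewrite /residual/= addrC addKr. Qed.

Lemma triple_law_rectangle (S S' : set R) : measurable S -> measurable S' ->
  triple_law (@context R @^-1` S `&` residual @^-1` S') =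
  (uniform_prob (@ltr01 R) S * nu S')%E.
Proof.
move=> mS mS'; rewrite /triple_law /distribution/= /pushforward.
rewrite (_ : _ @^-1` _ = S `*` S'); first exact: product_measure1E.
by apply/seteqP; split => v /=; rewrite residual_triple_of.
Qed.

Lemma triple_law_residual (S : set R) : measurable S ->
  triple_law (residual @^-1` S) = nu S.
Proof.
move=> mS.
rewrite -[LHS](_ : triple_law (@context R @^-1` setT `&` residual @^-1` S) = _).
  rewrite triple_law_rectangle// [X in (X * _)%E]probability_setT mul1e//.
by rewrite preimage_setT setTI.
Qed.

Lemma triple_law_context (S : set R) : measurable S ->
  triple_law (@context R @^-1` S) = uniform_prob (@ltr01 R) S.
Proof.
move=> mS.
rewrite -[LHS](_ : triple_law (@context R @^-1` S `&` residual @^-1` setT) = _).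
  by rewrite triple_law_rectangle// [X in (_ * X)%E]probability_setT mule1.
by rewrite preimage_setT setIT.
Qed.

Lemma cdf_residual t :
  cdf (residual : {RV triple_law >-> R}) t = nu `]-oo, t]%classic.
Proof. exact: triple_law_residual. Qed.

Lemma probability_itvB (m : probability R R) (s t : R) : s <= t ->
  (m `]-oo, t]%classic - m `]-oo, s]%classic = m `]s, t]%classic)%E.
Proof.
move=> st.
have -> : `]-oo, t]%classic = `]-oo, s]%classic `|` `]s, t]%classic.
  apply/seteqP; split => x /=; rewrite !in_itv/=.
    by move=> xt; have [xs|xs] := leP x s; [left|right; rewrite xt].
  by move=> [xs|/andP[]//]; exact: le_trans st.
rewrite measureU//; last first.
  apply/seteqP; split => x //= [] /=; rewrite !in_itv/= => xs /andP[sx _].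
  by move: (lt_le_trans sx xs); rewrite ltxx.
by rewrite addeAC subee ?add0e// fin_num_measure.
Qed.

(** The slope condition at the negative t follows from that at - t, the noise
    having symmetric law. *)
Lemma laws_triple_law (Ctil L : R) : expR (- rho * L) < 1 - 2 * Ctil * L ->
  (forall b, monotone01 (F b)) -> laws Ctil L triple_law F.
Proof.
move=> hL monoF; split => //; first exact: triple_law_context.
exists residual; split.
- have mN : measurable [set z : triple R | z.2.2 != F true z.1 + residual z].
    rewrite (_ : [set z | _] = (fun z : triple R =>
        z.2.2 == F true z.1 + residual z) @^-1` [set false]); last first.
      by apply/seteqP; split => z /= => [/negbTE|->].
    rewrite -[X in measurable X]setTI; apply: measurable_fun_eqr => //.
      by do 2!apply: (measurableT_comp measurable_snd).
    by apply: measurable_funD => //; exact: measurableT_comp.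
  exists [set z : triple R | z.2.2 != F true z.1 + residual z]; split => //.
    rewrite /triple_law/= /distribution /pushforward.
    rewrite (_ : _ @^-1` _ = set0) ?measure0//.
    by apply/seteqP; split => v //=; rewrite residual_triple_of eqxx.
  move=> z /= nz; apply/negP => /eqP zE; apply: nz => -[] //=.
  by rewrite /residual /context addrC subrK.
- move=> S S' mS mS'.
  by rewrite triple_law_context// triple_law_residual// triple_law_rectangle.
- have [int0 mean0] := noise_marginal (f := residual) triple_law_residual.
  by split => //; rewrite unlock.
- move=> S mS; rewrite triple_law_residual// -noiseN//.
  rewrite -triple_law_residual//.
  by rewrite -[X in measurable X]setTI; exact: oppr_measurable.
- have nuB (x y : R) (xy : x <= y) :
      (nu `]-oo, y]%classic - nu `]-oo, x]%classic = nu `]x, y]%classic)%E.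
    exact: probability_itvB.
  move=> t t0; rewrite in_itv/= => /andP[Lt tL].
  rewrite [X in (_ < `|X - _|)%E]cdf_residual [X in (_ < `|_ - X|)%E]cdf_residual.
  have [tpos|tneg] := ltP 0 t.
    rewrite nuB ?ltW// gee0_abs//.
    by have [|+ _] := @noise_itv _ _ rho0 _ _ hL t; rewrite ?tpos// gtr0_norm.
  have tn : 0 < - t by rewrite oppr_gt0 lt_neqAle t0.
  rewrite (_ : `|_ - _| = nu `]t, 0%R]%classic)%E; last first.
    rewrite -nuB//.
    have f1 : nu `]-oo, t]%classic \is a fin_num by rewrite fin_num_measure.
    have f2 : nu `]-oo, 0%R]%classic \is a fin_num by rewrite fin_num_measure.
    rewrite -[RHS]gee0_abs; last by rewrite nuB.
    by rewrite -(fineK f1) -(fineK f2) -!EFinB !abse_EFin distrC.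
  have [|_] := @noise_itv _ _ rho0 _ _ hL (- t).
    by rewrite tn lerNl.
  by rewrite opprK ler0_norm.
Qed.

End Law.

Section Regret.
Context {R : realType} (rho : R) (rho0 : 0 < rho) {T : nat}.
Local Open Scope ereal_scope.
Notation sample := (T.-tuple (triple R)).
Notation play := (T.-tuple (R * R)%type).
Notation lam := (round_law rho0).
Notation mu := (iid lam T).
Variable F : bool -> R -> R.
Hypothesis mF : forall b, measurable_fun setT (F b).

Definition world_mfun : {mfun play >-> sample} :=
  HB.pack (world F) (isMeasurableFun.Build _ _ _ _ (world F) (measurable_world mF)).

Definition sample_law : probability sample R := distribution mu world_mfun.

Lemma iid_law_sample_law : iid_law (triple_law rho0 mF) sample_law.
Proof.
move=> S mS.
transitivity (mu (rectangle (fun i => triple_of F @^-1` S i))).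
  rewrite /sample_law/= /distribution /pushforward; congr (mu _).
  by apply/seteqP; split => z /= Sz i; have := Sz i; rewrite tnth_mktuple.
rewrite iid_rectangle// => i; rewrite -[X in measurable X]setTI.
exact: measurable_triple_of.
Qed.

Hypothesis F01 : forall b x, (0 <= F b x <= 1)%R.

Variable A : 'I_T -> sample -> bool.
Hypothesis pA : forall i b, information A i (A i @^-1` [set b]).

Lemma play_noise_marginal (i : 'I_T) (S : set R) : measurable S ->
  mu ((fun z : play => (tnth z i).2) @^-1` S) = noise rho0 S.
Proof.
move=> mS.
pose S' j := if j == i then setT `*` S else setT : set (R * R).
transitivity (mu (rectangle S')).
  congr (mu _); apply/seteqP; split => z /=.
    by move=> Sz j; rewrite /S'; case: eqP => [->|].
  by move=> /(_ i); rewrite /S' eqxx => -[].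
rewrite iid_rectangle; last first.
  by move=> j; rewrite /S'; case: ifP => // _; exact: measurableX.
rewrite (bigD1 i)//= big1 ?mule1; last first.
  by move=> j /negPf ji; rewrite /S' ji; exact: probability_setT.
rewrite /S' eqxx; rewrite [LHS]product_measure1E//.
by rewrite [X in X * _]probability_setT mul1e.
Qed.

(** The noise of round i is common to both arms, so it has mean 0 in the
    regret whatever arm is played; the rest of the regret is a function of
    the context and of the decision, hence of the observed history. *)
Lemma expected_round_regret (i : 'I_T) :
  'E_sample_law[(fun w => Fstar F (X_ i w) - Y_ A i w)%R] =
  \int[mu]_z ((Fstar F (tnth z i).1 - mean (arm A) F i z) *
               sqrt_lik rho (arm A) F i z ^+ 2)%:E.
Proof.
have mFs : measurable_fun setT (Fstar F) by exact: measurable_maxr.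
have mA := measurable_policy pA.
have mx : measurable_fun setT (fun z : play => Fstar F (tnth z i).1).
  by apply: (measurableT_comp mFs); exact: measurable_play1.
pose gap (z : play) :=
  (Fstar F (tnth z i).1 - F (A i (world F z)) (tnth z i).1)%R.
have Fs01 x : (0 <= Fstar F x <= 1)%R.
  case/andP: (F01 false x) (F01 true x) => a0 a1 /andP[b0 b1].
  by rewrite /Fstar le_max ge_max a0 a1 b1.
have mFA : measurable_fun setT (fun z : play => F (A i (world F z)) (tnth z i).1).
  rewrite (_ : (fun z => _) = fun z : play => if A i (world F z)
    then F true (tnth z i).1 else F false (tnth z i).1); last first.
    by apply/funext => z; case: (A i _).
  apply: measurable_fun_ifT.
  - by apply: (measurableT_comp (mA i)); exact: measurable_world.
  - by apply: (measurableT_comp (mF true)); exact: measurable_play1.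
  - by apply: (measurableT_comp (mF false)); exact: measurable_play1.
have mgap : measurable_fun setT gap by exact: measurable_funB.
have gap0 z : (0 <= gap z)%R.
  by rewrite subr_ge0 /Fstar le_max; case: (A i _); rewrite lexx ?orbT.
have gap1 z : (gap z <= 1)%R.
  have := Fs01 (tnth z i).1; have := F01 (A i (world F z)) (tnth z i).1.
  by rewrite /gap; lra.
have igap : mu.-integrable setT (EFin \o gap).
  apply/integrableP; split; first exact/measurable_EFinP.
  apply: (@le_lt_trans _ _ (\int[mu]_z 1)).
    apply: ge0_le_integral => //.
    - by apply: measurableT_comp => //; exact/measurable_EFinP.
    - by move=> z _; rewrite /= ger0_norm// lee_fin.
  by rewrite integral_cst// [X in _ * X]probability_setT mule1 ltry.
have mn : measurable_fun setT (fun z : play => (tnth z i).2).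
  exact: measurable_play2.
pose nm : {mfun play >-> R} := HB.pack (fun z : play => (tnth z i).2)
  (isMeasurableFun.Build _ _ _ _ (fun z : play => (tnth z i).2) mn).
have [inoise noise0] := noise_marginal (f := nm) (play_noise_marginal i).
have regretE z : (Fstar F (X_ i (world F z)) - Y_ A i (world F z) =
    gap z - (tnth z i).2)%R.
  by rewrite Y_world /X_ tnth_mktuple /= /gap opprD addrA.
rewrite unlock.
transitivity (\int[mu]_z (gap z - (tnth z i).2)%:E).
  rewrite integral_distribution.
  - by apply: eq_integral => z _; rewrite /= regretE.
  - apply/measurable_EFinP/measurable_funB.
      by apply: (measurableT_comp mFs); exact: measurable_X.
    by apply: measurable_outcome => //; exact: measurable_tnth.
  - rewrite (_ : _ \o _ = fun z => (gap z)%:E - (tnth z i).2%:E).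
      exact: (integrableB _ igap inoise).
    by apply/funext => z; rewrite /= regretE EFinB.
under eq_integral do rewrite EFinB.
rewrite (integralB _ igap inoise)// noise0 sube0.
pose h (z : play) := (Fstar F (tnth z i).1 - mean (arm A) F i z)%R.
have mh : measurable_fun setT h.
  apply: measurable_funB => //; apply: measurable_mean => // j.
  exact: measurable_arm.
transitivity (\int[mu]_z (h (observed A F i z))%:E).
  by apply: eq_integral => z _; rewrite /h /gap /mean arm_observed// !observed1.
rewrite (integral_observed rho0 pA mF (g := fun z => (h z)%:E)).
- by apply: eq_integral => z _; rewrite EFinM.
- exact: ltnW.
- exact/measurable_EFinP.
- move=> z; rewrite lee_fin subr_ge0 /Fstar /mean le_max.
  by case: (arm A i z); rewrite lexx ?orbT.
Qed.

End Regret.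

(** * Staircase regression functions *)

Section Averaging.
Context {R : realFieldType} (k T : nat).
Implicit Types (s : {ffun 'I_k -> bool}).

Definition flip (j : 'I_k) s : {ffun 'I_k -> bool} :=
  [ffun l => if l == j then ~~ s l else s l].

Lemma flipK j : involutive (flip j).
Proof.
by move=> s; apply/ffunP => l; rewrite !ffunE; case: eqP; rewrite ?negbK.
Qed.

(** Flipping sign j is a bijection of the sign vectors, so the mean of
    r s i j over s is half the mean of r s i j + r (flip j s) i j. *)
Lemma flip_average (c : R) (r : {ffun 'I_k -> bool} -> 'I_T -> 'I_k -> R) :
  (forall s i j, c <= r s i j + r (flip j s) i j) ->
  exists s, (k * T)%:R * c / 2 <= \sum_i \sum_j r s i j.
Proof.
move=> rc; apply/not_existsP => rs.
pose N := #|{ffun 'I_k -> bool}|.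
have N0 : 0 < N%:R :> R by rewrite ltr0n; apply/card_gt0P; exists [ffun=> true].
have up : \sum_s \sum_i \sum_j r s i j < N%:R * ((k * T)%:R * c / 2).
  rewrite mulr_natl -sumr_const; apply: ltr_sum => [|s _].
    by apply/hasP; exists [ffun=> true]; rewrite ?mem_index_enum.
  by rewrite ltNge; apply/negP; exact: rs.
have lo : N%:R * ((k * T)%:R * c / 2) <= \sum_s \sum_i \sum_j r s i j.
  rewrite exchange_big/=.
  under eq_bigr do rewrite exchange_big/=.
  have -> : N%:R * ((k * T)%:R * c / 2) =
      \sum_(i < T) \sum_(j < k) (2^-1 * (N%:R * c)).
    by rewrite !sumr_const !card_ord -mulrnA -mulr_natl; ring.
  apply: ler_sum => i _; apply: ler_sum => j _.
  rewrite mulrC ler_pdivrMr// mulr_natr mulr2n.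
  rewrite [X in _ <= _ + X](reindex_inj (inv_inj (flipK j)))/= -big_split/=.
  by rewrite mulr_natl -sumr_const; apply: ler_sum => s _.
by move: (lt_le_trans up lo); rewrite ltxx.
Qed.

End Averaging.

Section Instance.
Context {R : realType} (k' : nat).
Notation k := k'.+1.
Implicit Types (x y : R) (j : 'I_k).

(** The truncation at k' puts the right end point 1 into the last bin, and
    makes the staircase a total function with values in [0, 1]. *)
Definition bin x : 'I_k := inord (minn (Num.truncn (k%:R * x)) k').

Lemma binE x : bin x = minn (Num.truncn (k%:R * x)) k' :> nat.
Proof. by rewrite /bin inordK// ltnS geq_minr. Qed.

Lemma le_bin x y : x <= y -> (bin x <= bin y)%N.
Proof.
move=> xy; rewrite !binE leq_min geq_minr andbT.
by rewrite (leq_trans (geq_minl _ _))//; apply: le_truncn; rewrite ler_pM2l.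
Qed.

Lemma bin_itv j x : j%:R / k%:R <= x < j.+1%:R / k%:R -> bin x = j.
Proof.
move=> /andP[jx xj]; apply: ord_inj; rewrite binE.
rewrite (@truncn_def _ _ j).
  by apply/minn_idPl; rewrite -ltnS.
by rewrite mulrC -ler_pdivrMr// jx -ltr_pdivlMr.
Qed.

Lemma bin_eq_itv j x : 0 <= x <= 1 -> bin x = j ->
  j%:R / k%:R <= x <= j.+1%:R / k%:R.
Proof.
move=> /andP[x0 x1] binx.
have jE : minn (Num.truncn (k%:R * x)) k' = j by rewrite -binE binx.
have kx0 : 0 <= k%:R * x by rewrite mulr_ge0.
rewrite ler_pdivrMr// ler_pdivlMr// [x * _]mulrC.
apply/andP; split.
  by rewrite -truncn_ge_nat// -jE geq_minl.
(* The truncation is effective only if k * x >= k, that is at x = 1. *)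
have [tk|kt] := leqP (Num.truncn (k%:R * x)) k'.
  by rewrite -jE (minn_idPl tk) ltW// truncnS_gt.
rewrite -jE (minn_idPr (ltnW kt)) -[leRHS]mulr1 ler_pM2l//.
Qed.

Lemma measurable_bin_eq j : measurable [set x | bin x = j].
Proof.
apply: is_interval_measurable => x y /= xj yj z /andP[xz zy].
apply/val_inj/eqP; rewrite eqn_leq -{1}yj -xj; apply/andP; split; exact: le_bin.
Qed.

Lemma unif01_bin j : unif01 [set x | bin x = j] = (k%:R^-1)%:E.
Proof.
have mj := measurable_bin_eq j.
(* The bin lies between the half-open and the closed interval. *)
have len (b : bool) : lebesgue_measure
   [set` Interval (BLeft (j%:R / k%:R : R)) (BSide b (j.+1%:R / k%:R : R))]
   = (k%:R^-1)%:E.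
  rewrite lebesgue_measure_itv/= lte_fin ltr_pM2r// ltr_nat ltnSn -EFinB.
  by rewrite -mulrBl -natrB// subSnn mul1r.
have uE A : measurable A ->
    unif01 A = lebesgue_measure (A `&` `[0, 1]%classic : set R).
  move=> mA; transitivity (uniform_prob (@ltr01 R) A) => //.
  rewrite [LHS]integral_uniform_pdf.
  rewrite (eq_integral (fun=> 1%E)); last first.
    move=> x; rewrite inE => -[_]/=; rewrite in_itv/= /uniform_pdf => ->.
    by rewrite subr0 invr1.
  by rewrite integral_cst ?mul1e//; exact: measurableI.
rewrite uE//; apply/eqP; rewrite eq_le; apply/andP; split.
  rewrite -(len false); apply: le_measure; rewrite ?inE//.
    exact: measurableI.
  by move=> x [/= xj]; rewrite !in_itv/= => x01; exact: bin_eq_itv.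
rewrite -(len true); apply: le_measure; rewrite ?inE//.
  exact: measurableI.
move=> x /=; rewrite !in_itv/= => /[dup] xj /bin_itv ->; split => //.
case/andP: xj => jx xj; rewrite (le_trans _ jx) ?divr_ge0//=.
by rewrite (le_trans (ltW xj))// ler_pdivrMr// mul1r ler_nat.
Qed.

Variable delta : R.
Hypotheses (delta0 : 0 < delta) (deltak : delta <= (8 * k%:R)^-1).

Definition level (s : {ffun 'I_k -> bool}) (b : bool) (j : 'I_k) : R :=
  4^-1 + j%:R / (2 * k%:R) + (if b then (if s j then delta else - delta) else 0).

Definition staircase (s : {ffun 'I_k -> bool}) (b : bool) (x : R) : R :=
  level s b (bin x).

Lemma level_lt s b (i j : 'I_k) : (i < j)%N -> level s b i < level s b j.
Proof.
move=> ij.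
have : i%:R + 1 <= j%:R :> R by rewrite natr1 ler_nat.
rewrite -(@ler_pM2r _ ((2 * k%:R)^-1)) ?invr_gt0 ?mulr_gt0// mulrDl mul1r => h.
have h2 : (2 * k%:R)^-1 = 4 * (8 * k%:R)^-1 :> R by field; rewrite addrC natr1.
move: delta0 deltak h h2; rewrite /level.
move: ((2 * k%:R)^-1) ((8 * k%:R)^-1) => u w d0 dw h h2.
move: (i%:R * u) (j%:R * u) h => iu ju h.
by case: b; [case: (s i); case: (s j)|]; lra.
Qed.

Lemma level01 s b j : 0 <= level s b j <= 1.
Proof.
have d8 : delta <= 8^-1.
  apply: le_trans deltak _.
  by rewrite lef_pV2 ?posrE ?mulr_gt0// ler_peMr// ler1n.
have j0 : 0 <= j%:R / (2 * k%:R) :> R by rewrite divr_ge0// mulr_ge0.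
have j1 : j%:R / (2 * k%:R) <= 2^-1 :> R.
  by rewrite ler_pdivrMr ?mulr_gt0// mulrA mulVf// mul1r ler_nat ltnW.
rewrite /level; move: delta0 d8 j0 j1; move: (j%:R / _) => u d0 d8 j0 j1.
by case: b; [case: (s j)|]; lra.
Qed.

Lemma le_staircase s b x y : x <= y -> staircase s b x <= staircase s b y.
Proof.
move=> /le_bin; rewrite leq_eqVlt => /orP[/eqP/ord_inj xy|xy].
  by rewrite /staircase xy.
by apply: ltW; exact: level_lt.
Qed.

Lemma measurable_staircase s b : measurable_fun setT (staircase s b).
Proof. by apply: nondecreasing_measurable => // x y; exact: le_staircase. Qed.

Lemma staircase_monotone01 s b : monotone01 (staircase s b).
Proof. by split => [x y _ _|x _]; [exact: le_staircase|exact: level01]. Qed.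

Lemma staircase_piecewise_constant s b : piecewise_constant k (staircase s b).
Proof.
exists (fun j => [set x | 0 <= x <= 1 /\ bin x = j]), (level s b); split.
- split.
  + apply/seteqP; split => x /=; rewrite in_itv/=; first by move=> [j _ []].
    by move=> x01; exists (bin x).
  + by move=> i j _ _ [x [[_ <-] [_ <-]]].
  + move=> j _; exists (j%:R / k%:R) => /=; split.
      by rewrite divr_ge0//= ler_pdivrMr// mul1r ler_nat ltnW.
    by apply: bin_itv; rewrite lexx ltr_pM2r// ltr_nat ltnSn.
- move=> j x y /= [/andP[x0 x1] xj] [/andP[y0 y1] yj] z /andP[xz zy]; split.
    by rewrite (le_trans x0 xz) (le_trans zy y1).
  apply/val_inj/eqP; rewrite eqn_leq -{1}yj -xj; apply/andP; split; exact: le_bin.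
- move=> i j ij; apply/val_inj/eqP; case: ltngtP => // /(level_lt s b);
  by rewrite ij ltxx.
- by move=> j x [_ <-].
Qed.

Lemma staircase_gap s b x :
  Fstar (staircase s) x - staircase s b x = delta * (b != s (bin x))%:R.
Proof.
rewrite /Fstar /staircase /level; move: (4^-1 + _) => u; move: delta0.
by case: (s (bin x)); case: b => /= d0; case: leP => /=; lra.
Qed.

End Instance.

(** * The averaged lower bound *)

Section Lower.
Context {R : realType} (rho : R) (rho0 : 0 < rho) (k' T : nat).
Notation k := k'.+1.
Notation mu := (iid (round_law rho0) T).
Notation play := (T.-tuple (R * R)%type).
Variable A : 'I_T -> T.-tuple (triple R) -> bool.
Hypothesis pA : forall i b, information A i (A i @^-1` [set b]).
Variable delta : R.
Hypotheses (delta0 : 0 < delta) (deltak : delta <= (8 * k%:R)^-1).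
Hypothesis rhod : rho * (2 * delta) <= 1.
Hypothesis budget : T%:R * ((rho * (2 * delta)) ^+ 2 / 2 * k%:R^-1) <= 4^-1.
Implicit Types s : {ffun 'I_k -> bool}.

Let mstep s := measurable_staircase delta0 deltak s.

(** The probability, when the signs are s, that the context of round i falls
    into bin j and the wrong arm is played: arm 1 is optimal on bin j
    exactly if s j is true. *)
Definition bin_error s (i : 'I_T) (j : 'I_k) : \bar R :=
  (\int[mu]_z (\1_[set x | bin k' x = j] (tnth z i).1 * (arm A i z != s j)%:R *
    sqrt_lik rho (arm A) (staircase delta s) i z ^+ 2)%:E)%E.

Let marm i : measurable_fun setT (arm A i).
Proof. exact: measurable_arm. Qed.

Let mlik s (i : 'I_T) :
  measurable_fun setT (sqrt_lik rho (arm A) (staircase delta s) i).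
Proof. exact: measurable_sqrt_lik. Qed.

Let mind (j : 'I_k) (i : 'I_T) :
  measurable_fun setT (fun z : play => \1_[set x | bin k' x = j] (tnth z i).1 : R).
Proof.
apply: (@measurableT_comp _ _ _ _ _ _ (\1_[set x | bin k' x = j] : R -> R)).
  by apply: measurable_indic; exact: measurable_bin_eq.
exact: measurable_play1.
Qed.

Let merr (i : 'I_T) (b : bool) :
  measurable_fun setT (fun z : play => (arm A i z != b)%:R : R).
Proof.
rewrite (_ : (fun z => _) = fun z : play => if arm A i z then (true != b)%:R
    else (false != b)%:R).
  by apply: measurable_fun_ifT => //; exact: marm.
by apply/funext => z; case: (arm A i z).
Qed.

Let mterm s (i : 'I_T) (j : 'I_k) : measurable_fun setT (fun z : play =>
  \1_[set x | bin k' x = j] (tnth z i).1 * (arm A i z != s j)%:R *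
    sqrt_lik rho (arm A) (staircase delta s) i z ^+ 2).
Proof.
by apply: measurable_funM; [exact: measurable_funM|exact: measurable_funX].
Qed.

Let term0 s (i : 'I_T) (j : 'I_k) (z : play) :
  0 <= \1_[set x | bin k' x = j] (tnth z i).1 * (arm A i z != s j)%:R *
    sqrt_lik rho (arm A) (staircase delta s) i z ^+ 2.
Proof. by apply: mulr_ge0; [exact: mulr_ge0|exact: sqr_ge0]. Qed.

Let bin_error_fin s i j : bin_error s i j \is a fin_num.
Proof.
rewrite ge0_fin_numE; last by apply: integral_ge0 => z _; rewrite lee_fin.
apply: (@le_lt_trans _ _ 1%E); last exact: ltry.
rewrite -(integral_lik rho0 (arm_nonanticipating pA) marm (mstep s)
  (ltnW (ltn_ord i))).
apply: ge0_le_integral => //.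
- by move=> z _; rewrite lee_fin.
- exact/measurable_EFinP.
- by apply/measurable_EFinP; exact: measurable_funX.
- move=> z _; rewrite lee_fin ler_piMl ?sqr_ge0//.
  by rewrite mulr_ile1// ?lern1 ?leq_b1// indicE lern1 leq_b1.
Qed.

Let expected_regretE s (i : 'I_T) :
  ('E_(sample_law rho0 (mstep s))[
      (fun w => Fstar (staircase delta s) (X_ i w) - Y_ A i w)%R] =
   delta%:E * \sum_j bin_error s i j)%E.
Proof.
rewrite (@expected_round_regret _ _ _ _ _ _ _ A)//; last first.
  by move=> b x; exact: level01.
rewrite ge0_sume_distrr; last first.
  by move=> j _; apply: integral_ge0 => z _; rewrite lee_fin.
under [RHS]eq_bigr => j _.
  rewrite -ge0_integralZl_EFin//; last 3 first.
  - by move=> z _; rewrite lee_fin.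
  - exact/measurable_EFinP.
  - exact: ltW.
  over.
rewrite -ge0_integral_sum//=; last 2 first.
- by move=> j; apply: measurable_funeM; exact/measurable_EFinP.
- by move=> j z _; rewrite mule_ge0// lee_fin// ltW.
apply: eq_integral => z _; rewrite sumEFin; congr EFin.
rewrite /mean staircase_gap// -mulr_sumr -mulrA; congr (_ * _).
rewrite -mulr_suml; congr (_ * _).
rewrite (bigD1 (bin k' (tnth z i).1))//= big1 ?addr0.
  by rewrite indicE mem_set// mul1r.
move=> j jb; rewrite indicE memNset ?mul0r//= => e.
by rewrite e eqxx in jb.
Qed.

Let flip_staircase s j b x : bin k' x <> j ->
  staircase delta s b x = staircase delta (flip j s) b x.
Proof. by move=> /eqP/negPf bj; rewrite /staircase /level ffunE bj. Qed.

Let flip_staircase_le s j b x :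
  `|staircase delta s b x - staircase delta (flip j s) b x| <= 2 * delta.
Proof.
rewrite /staircase /level ffunE; move: (4^-1 + _) => u.
rewrite ler_norml; move: delta0 => d0.
by case: b; [case: (_ == j); case: (s _) => /=|]; lra.
Qed.

(** By two_point with the hypotheses s and flip j s, the errors on bin j add
    up to at least 1 / (4 k) in each round; averaging over s gives a sign
    vector with T / 8 expected errors, each of cost delta. *)
Lemma regret_staircase : exists s,
  ((delta * T%:R / 8)%:E <=
   regret (sample_law rho0 (mstep s)) (staircase delta s) A)%E.
Proof.
have pair s i j : (4 * k%:R)^-1 <=
    fine (bin_error s i j) + fine (bin_error (flip j s) i j).
  rewrite -lee_fin EFinD !fineK//.
  have := @two_point _ _ rho0 _ _ (arm_nonanticipating pA) marm
    _ _ (mstep s) (mstep (flip j s)) _ _ _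
    (measurable_bin_eq j) (unif01_bin j) (fun b x => @flip_staircase s j b x)
    (fun b x => flip_staircase_le s j b x) rhod i (~~ s j) budget.
  rewrite invfM mulrC; congr (_ <= _ + _)%E.
    by apply: eq_integral => z _; case: (arm A i z); case: (s j).
  by apply: eq_integral => z _; rewrite ffunE eqxx.
have [s sP] := flip_average pair; exists s.
rewrite /regret (eq_bigr _ (fun i _ => expected_regretE s i)).
rewrite -ge0_sume_distrr; last first.
  by move=> i _; apply: sume_ge0 => j _; apply: integral_ge0 => z _; rewrite lee_fin.
rewrite -mulrA EFinM lee_pmul2l ?lte_fin//.
rewrite (_ : (\sum_(i < T) _)%E = (\sum_i \sum_j fine (bin_error s i j))%:E).
  rewrite lee_fin; apply: le_trans sP.
  rewrite natrM invfM [leRHS](_ : _ = T%:R / 8)//.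
  by field; rewrite addrC natr1.
rewrite -sumEFin; apply: eq_bigr => i _; rewrite -sumEFin.
by apply: eq_bigr => j _; rewrite fineK.
Qed.

End Lower.

(** * Minimax bounds *)

(** The distribution function of the noise grows by more than Ctil * L on
    either side of 0 and by at most 1 in total. *)
Lemma laws_slope_bound (R : realType) (Ctil L : R) (D : probability (triple R) R)
    (F : bool -> R -> R) : 0 < L -> laws Ctil L D F -> 2 * Ctil * L < 1.
Proof.
move=> L0 [_ _ [eps [_ _ _ _ epsA]]].
have fin t : cdf eps t \is a fin_num by rewrite fin_num_measure.
have cdfr t : cdf eps t = (fine (cdf eps t))%:E by rewrite fineK.
have le x y : x <= y -> fine (cdf eps x) <= fine (cdf eps y).
  by move=> xy; rewrite fine_le// cdf_nondecreasing.
have := epsA L (lt0r_neq0 L0).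
rewrite in_itv/= lexx (le_trans _ (ltW L0)) ?oppr_le0 ?ltW//.
move=> /(_ isT); rewrite (cdfr L) (cdfr 0) -EFinB abse_EFin lte_fin.
rewrite (gtr0_norm L0) [X in _ < X]ger0_norm; last first.
  by rewrite subr_ge0 le// ltW.
move=> up.
have := epsA (- L); rewrite oppr_eq0 lt0r_neq0// in_itv/= lexx.
rewrite (@le_trans _ _ 0) ?oppr_le0 ?ltW//.
move=> /(_ isT isT); rewrite (cdfr (- L)) (cdfr 0) -EFinB abse_EFin lte_fin normrN.
rewrite (gtr0_norm L0) distrC [X in _ < X]ger0_norm; last first.
  by rewrite subr_ge0 le// oppr_le0 ltW.
move=> lo.
have := cdf_le1 eps L; have := cdf_ge0 eps (- L).
rewrite (cdfr L) (cdfr (- L)) !lee_fin; lra.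
Qed.

Lemma exists_rate (R : realType) (Ctil L : R) : 0 < L -> 2 * Ctil * L < 1 ->
  exists2 rho : R, 0 < rho & expR (- rho * L) < 1 - 2 * Ctil * L.
Proof.
move=> L0 CL; pose e := 1 - 2 * Ctil * L.
have e0 : 0 < e by rewrite subr_gt0.
exists ((e * L)^-1); first by rewrite invr_gt0 mulr_gt0.
have -> : - (e * L)^-1 * L = - e^-1 by field; rewrite !gt_eqF.
rewrite expRN -/e; have := expR_ge1Dx e^-1; have := invr_gt0 e; rewrite e0 => i0 h.
rewrite -[ltRHS]invrK ltf_pV2 ?posrE ?invr_gt0 ?expR_gt0//; lra.
Qed.

Section Minimax.
Context {R : realType} (Ctil L rho : R) (rho0 : 0 < rho).
Hypothesis slope : expR (- rho * L) < 1 - 2 * Ctil * L.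

(** The gap will be gap_scale * sqrt (k / T).  The bound 1/8 keeps the steps
    increasing and the levels in [0, 1]; the bound 1 / (4 rho) makes the
    total loss of affinity 2 (rho * gap_scale)^2 at most 1/8. *)
Definition gap_scale : R := Num.min 8^-1 (4 * rho)^-1.

Lemma gap_scale_gt0 : 0 < gap_scale.
Proof. by rewrite lt_min !invr_gt0 mulr_gt0 ?andbT. Qed.

Lemma exists_hard_law (k T : nat) (A : 'I_T -> T.-tuple (triple R) -> bool) :
  (1 <= k)%N -> (1 <= T)%N -> (k ^ 3 <= T)%N -> policy A ->
  exists D F P, [/\ laws_k k Ctil L D F, iid_law D P &
    ((gap_scale / 8 * Num.sqrt (k * T)%:R)%:E <= regret P F A)%E].
Proof.
case: k => // k' _ T0 kT pA; set k := k'.+1.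
have c0 := gap_scale_gt0.
have TR0 : 0 < T%:R :> R by rewrite ltr0n.
have kR0 : 0 < k%:R :> R by rewrite ltr0n.
have kT0 : 0 < (k * T)%:R :> R by rewrite ltr0n muln_gt0.
pose u : R := Num.sqrt (k * T)%:R.
have u0 : 0 < u by rewrite sqrtr_gt0.
have ug0 := ltW u0; have cg0 := ltW c0.
have u2 : u ^+ 2 = (k * T)%:R by rewrite sqr_sqrtr// ltW.
have uk : u * k%:R <= T%:R.
  rewrite -(@ler_pXn2r _ 2) ?nnegrE ?mulr_ge0// exprMn u2 -!natrX -natrM ler_nat.
  have -> : (k * T * k ^ 2 = k ^ 3 * T)%N by rewrite mulnAC -expnS.
  by rewrite -mulnn leq_mul2r kT orbT.
have uT : u <= T%:R.
  by apply: le_trans uk; rewrite ler_peMr// ler1n.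
pose delta := gap_scale * u / T%:R.
have delta0 : 0 < delta by rewrite divr_gt0// mulr_gt0.
have c8 : gap_scale <= 8^-1 by rewrite ge_min lexx.
have crho : rho * gap_scale <= 4^-1.
  have : gap_scale <= (4 * rho)^-1 by rewrite ge_min lexx orbT.
  by rewrite invfM ler_pdivlMr// mulrC.
have deltak : delta <= (8 * k%:R)^-1.
  rewrite /delta invfM -mulrA ler_pM//; first by rewrite divr_ge0.
  by rewrite ler_pdivrMr// mulrC ler_pdivlMr.
have deltac : delta <= gap_scale.
  by rewrite /delta -mulrA ler_piMr// ler_pdivrMr ?mul1r.
have rhod : rho * (2 * delta) <= 1.
  have : rho * delta <= rho * gap_scale by rewrite ler_pM2l.
  lra.
have budget : T%:R * ((rho * (2 * delta)) ^+ 2 / 2 * k%:R^-1) <= 4^-1.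
  have -> : T%:R * ((rho * (2 * delta)) ^+ 2 / 2 * k%:R^-1) =
      2 * (rho * gap_scale) ^+ 2 * (u ^+ 2 / (k%:R * T%:R)).
    by rewrite /delta; field; rewrite !gt_eqF.
  rewrite u2 natrM divff ?mulr1; last by rewrite mulf_neq0 ?gt_eqF.
  have : 0 <= rho * gap_scale by rewrite mulr_ge0// ltW.
  move: (rho * gap_scale) crho => v v4 v0.
  have : v ^+ 2 <= 4^-1 ^+ 2 by rewrite ler_pXn2r ?nnegrE.
  lra.
have [s sP] := regret_staircase rho0 pA delta0 deltak rhod budget.
exists (triple_law rho0 (measurable_staircase delta0 deltak s)),
  (staircase delta s),
  (sample_law rho0 (measurable_staircase delta0 deltak s)); split.
- split; last by move=> b; exact: staircase_piecewise_constant.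
  by apply: laws_triple_law => // b; exact: staircase_monotone01.
- exact: iid_law_sample_law.
- apply: le_trans sP; rewrite lee_fin /delta -/u.
  by rewrite divfK ?gt_eqF// mulrAC.
Qed.

Lemma minimax_regret_ge (k T : nat)
    (C : probability (triple R) R -> (bool -> R -> R) -> Prop) :
  (forall D F, laws_k k Ctil L D F -> C D F) ->
  (1 <= k)%N -> (1 <= T)%N -> (k ^ 3 <= T)%N ->
  ((gap_scale / 8 * Num.sqrt (k * T)%:R)%:E <= minimax_regret T C)%E.
Proof.
move=> kC k0 T0 kT; apply: le_ereal_inf_tmp => _ [A pA <-].
have [D [F [P [DF DP le]]]] := exists_hard_law k0 T0 kT pA.
apply: le_ereal_sup_tmp; exists (regret P F A) => //.
by exists D, F, P; split => //; exact: kC.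
Qed.

End Minimax.

(** The largest k with k ^ 3 <= T has T < (k + 1) ^ 3 <= 8 k ^ 3. *)
Lemma cube_root_pieces (R : realType) (T : nat) : (1 <= T)%N ->
  exists k : nat, [/\ (1 <= k)%N, (k ^ 3 <= T)%N &
    T%:R `^ (2 / 3) <= 2 * Num.sqrt (k * T)%:R :> R].
Proof.
move=> T0.
have ex : exists k : nat, (k ^ 3 <= T)%N by exists 1%N.
(* A crude bound on the candidates, needed to take the largest. *)
have bd k : (k ^ 3 <= T)%N -> (k <= T)%N.
  by apply: leq_trans; case: k => // k; rewrite -{1}(expn1 k.+1) leq_pexp2l.
case: (ex_maxnP ex bd) => k kT kmax; exists k.
have k0 : (1 <= k)%N by exact: (kmax 1%N).
split => //.
have Tk : (T < k.+1 ^ 3)%N by rewrite ltnNge; apply/negP => /kmax; rewrite ltnn.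
have Tk8 : (T <= (2 * k) ^ 3)%N.
  by apply: leq_trans (ltnW Tk) _; rewrite leq_exp2r// mul2n -addnn -addn1 leq_add2l.
pose u : R := T%:R `^ (3^-1).
have u0 : 0 <= u by exact: powR_ge0.
have u3 : u ^+ 3 = T%:R.
  by rewrite -powR_mulrn// -powRrM mulVf// powRr1.
have -> : T%:R `^ (2 / 3) = u ^+ 2.
  by rewrite -powR_mulrn// -powRrM mulrC.
have uk : u <= 2 * k%:R.
  by rewrite -(@ler_pXn2r _ 3) ?nnegrE ?mulr_ge0// u3 -natrM -natrX ler_nat.
rewrite -ler_pdivrMl// -[leLHS]ger0_norm ?mulr_ge0// -sqrtr_sqr ler_wsqrtr//.
rewrite natrM -u3; have h := ler_wpM2r (exprn_ge0 3 u0) uk.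
have : 0 <= k%:R * u ^+ 3 by rewrite mulr_ge0 ?exprn_ge0.
by rewrite exprMn -exprM; move: h; rewrite -exprS => h h'; lra.
Qed.

Theorem lemma1 (R : realType) (Ctil L : R) (hC : 0 < Ctil) (hL : 0 < L)
    (hne : exists D F, laws Ctil L D F) :
  exists c : R, 0 < c /\
    forall k T : nat, (1 <= k)%N -> (1 <= T)%N ->
      ((c * T%:R `^ (2 / 3))%:E <= minimax_regret T (laws Ctil L))%E /\
      ((k ^ 3 <= T)%N ->
        ((c * Num.sqrt (k * T)%:R)%:E
          <= minimax_regret T (laws_k k Ctil L))%E).
Proof.
have [D [F DF]] := hne.
have [rho rho0 slope] := exists_rate hL (laws_slope_bound hL DF).
have c0 := gap_scale_gt0 rho0.
exists (gap_scale rho / 16); split; first by rewrite divr_gt0.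
move=> k T k0 T0; split => [|kT].
  have [m [m0 mT TE]] := cube_root_pieces R T0.
  apply: le_trans (minimax_regret_ge rho0 slope _ m0 T0 mT).
    rewrite lee_fin; have := ler_wpM2l (ltW c0) TE; lra.
  by move=> D' F' [].
apply: le_trans (minimax_regret_ge rho0 slope _ k0 T0 kT) => //.
rewrite lee_fin ler_wpM2r ?sqrtr_ge0// ler_pM2l//; lra.
Qed.
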